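(* Let $\Pi$ be an EFC process with characteristics $(c_k,\nu_{Coag},c_e,\nu_{Disl})$, not all zero, and let $\rho$ be its unique stationary probability measure on $\mathcal P$. 1. If $\Pi$ fragmentates quickly, i.e. $c_e>0$ or $\nu_{Disl}(\mathcal S^\downarrow)=\infty$, then $\rho(\{\pi\in\mathcal P:\#\pi<\infty\})=0$. 2. If $\Pi$ fragmentates slowly, i.e. $c_e=0$ and $\nu_{Disl}(\mathcal S^\downarrow)<\infty$, and if $\nu_{Disl}(\{x\in\mathcal S^\downarrow:x_1+x_2<1\})=0$, then $$c_k>0\ \Longrightarrow\ \rho(\{\pi\in\mathcal P:\#\pi<\infty\})=1.$$
   Context: Partitions. $\mathbb N=\{1,2,\dots\}$, $[n]=\{1,\dots,n\}$. $\mathcal P$ (resp. $\mathcal P_n$) is the set of partitions of $\mathbb N$ (resp. $[n]$); $\pi=(B_1,B_2,\dots)$ lists the blocks in increasing order of least element (followed by empty blocks if there are finitely many). $i\overset{\pi}{\sim}j$ means $i,j$ are in the same block of $\pi$; $\pi_{|[n]}$ is the restriction to $[n]$; $\#\pi$ is the number of non-empty blocks; $\mathbf 0$ is the partition into singletons, $\mathbf 1$ the one-block partition, $\mathbf 0_n,\mathbf 1_n$ their restrictions to $[n]$. $\mathcal P$ carries the compact metric $d(\pi,\pi')=1/\max\{n:\pi_{|[n]}=\pi'_{|[n]}\}$ ($0$ if $\pi=\pi'$). For a permutation $\sigma$, $\sigma(\pi)$ is defined by $i\overset{\sigma(\pi)}{\sim}j\iff\sigma(i)\overset{\pi}{\sim}\sigma(j)$.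 A random partition or $\mathcal P$-valued process is exchangeable if its law is invariant under every permutation $\sigma$ of $\mathbb N$ with $\sigma(n)=n$ for all large $n$. Operators. For $\pi=(B_i)$, $\pi'=(B'_j)$: $Coag(\pi,\pi')$ has blocks $\bigcup_{i\in B'_j}B_i$; $Frag(\pi,\pi',k)$ keeps every $B_i$, $i\ne k$, and replaces $B_k$ by the non-empty sets $B_k\cap B'_j$. For $\pi\in\mathcal P_n$, $Coag(\pi,\pi')$ is defined likewise for $\pi'\in\mathcal P_{\#\pi}$, and for $\pi'\in\mathcal P_{|B_k|}$, $Frag(\pi,\pi',k)$ is defined by identifying $B_k$ with $[|B_k|]$ via the increasing bijection. EFC processes. An EFC (exchangeable fragmentation-coalescence) process is an exchangeable $\mathcal P$-valued Markov process $(\Pi(t))_{t\ge0}$ whose restrictions $\Pi_{|[n]}$ are càdlàg finite-state Markov chains whose transition rates $q_n(\pi,\pi')$ are non-zero only if $\pi'=Coag(\pi,\pi'')$ for some $\pi''$ or $\pi'=Frag(\pi,\pi'',k)$ for some $\pi'',k$. Characteristics. $\mathcal S^\downarrow=\{x=(x_1\ge x_2\ge\dots\ge0):\sum_i x_i\le1\}$. For $x\in\mathcal S^\downarrow$, $\mu_x$ is the law of the partition with $i\sim j\iff X_i=X_j$, where the $X_i$ are independent, $P(X_i=k)=x_k$ ($k\ge1$), $P(X_i=-i)=1-\sum_jx_j$; $\mu_\nu=\int\mu_x\,\nu(dx)$. $\mathbf e=\sum_n\delta_{\epsilon_n}$, $\epsilon_n$ having blocks $\{n\}$, $\mathbb N\setminus\{n\}$;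 $\kappa=\sum_{i<j}\delta_{\epsilon_{i,j}}$, $\epsilon_{i,j}$ having $\{i,j\}$ as only non-singleton block. Characteristics are $c_k,c_e\ge0$ and measures $\nu_{Coag},\nu_{Disl}$ on $\mathcal S^\downarrow$ with $\nu_{Coag}(\{(0,0,\dots)\})=0$, $\int\sum_ix_i^2\,\nu_{Coag}(dx)<\infty$, $\nu_{Disl}(\{(1,0,\dots)\})=0$, $\int(1-\sum_ix_i^2)\,\nu_{Disl}(dx)<\infty$. With $C=c_k\kappa+\mu_{\nu_{Coag}}$ and $F=c_e\mathbf e+\mu_{\nu_{Disl}}$, an EFC process has these characteristics if, for $\pi\in\mathcal P_n$ with $m$ blocks, $q_n(\pi,Coag(\pi,\pi'))=C(\{\pi'':\pi''_{|[m]}=\pi'\})$ for $\pi'\in\mathcal P_m\setminus\{\mathbf 0_m\}$, $q_n(\pi,Frag(\pi,\pi',k))=F(\{\pi'':\pi''_{|[|B_k|]}=\pi'\})$ for $\pi'\in\mathcal P_{|B_k|}\setminus\{\mathbf 1_{|B_k|}\}$, and all other rates vanish. Every EFC process has unique characteristics, and when these are not all zero it has a unique stationary probability measure $\rho$ on $\mathcal P$, which is exchangeable; the image of $\rho$ under $\pi\mapsto\pi_{|[n]}$ is the unique stationary distribution of the chain with rates $q_n$. *)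

(* Defs.v *)
(* MathComp / MathComp-Analysis. *)
From HB Require Import structures.
From mathcomp Require Import all_boot all_order all_algebra.
From mathcomp Require Import all_classical all_reals all_analysis.

Set Implicit Arguments.
Unset Strict Implicit.
Unset Printing Implicit Defensive.

Import Order.TTheory GRing.Theory Num.Theory.
Import numFieldNormedType.Exports.

(* The element n >= 1 of the base set {1, 2, ...} is encoded as the nat n.-1:
   [n] is 'I_n, and blocks, the terms of a sequence x in S^down and the
   variables X_i are all numbered from 0. *)

Definition is_part n (p : {set {set 'I_n}}) : bool :=
  finset.partition p [set: 'I_n]%SET.

Definition least n (B : {set 'I_n}) : nat := (\big[minn/n]_(i in B) i)%N.

Definition blocks n (a : {set {set 'I_n}}) : seq {set 'I_n} :=
  sort (fun A B => (least A <= least B)%N) (enum a).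

Definition block n (a : {set {set 'I_n}}) (k : nat) : {set 'I_n} :=
  nth finset.set0 (blocks a) k.

Definition zero_part n : {set {set 'I_n}} := [set [set i] | i : 'I_n]%SET.

Definition one_part n : {set {set 'I_n}} := [set [set: 'I_n]]%SET.

Definition coag n (a : {set {set 'I_n}}) (p : {set {set 'I_#|a|}})
    : {set {set 'I_n}} :=
  [set \bigcup_(i in B) block a i | B : {set 'I_#|a|} in p]%SET.

(* [enum_val] is the increasing bijection from [#|B_k|] onto B_k. *)
Definition frag n (a : {set {set 'I_n}}) (k : 'I_#|a|)
    (p : {set {set 'I_#|block a k|}}) : {set {set 'I_n}} :=
  ((a :\ block a k) :|:
   [set [set enum_val i | i in A] | A : {set 'I_#|block a k|} in p])%SET.

Definition is_coag n (a b : {set {set 'I_n}}) : Prop :=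
  exists2 p : {set {set 'I_#|a|}}, is_part p & b = coag p.

Definition is_frag n (a b : {set {set 'I_n}}) : Prop :=
  exists (k : 'I_#|a|) (p : {set {set 'I_#|block a k|}}),
    is_part p /\ b = frag p.

Local Open Scope classical_set_scope.
Local Open Scope ring_scope.

Record partN := PartN {
  part_rel :> rel nat ;
  part_relP : [/\ reflexive part_rel, symmetric part_rel
                & transitive part_rel] }.

Lemma eq_partP : [/\ reflexive (@eq_op nat), symmetric (@eq_op nat)
                   & transitive (@eq_op nat)].
Proof. by split=> [x|x y|y x z /eqP -> //]; rewrite ?eqxx // eq_sym. Qed.

Definition part0 : partN := PartN eq_partP.

HB.instance Definition _ := gen_eqMixin partN.
HB.instance Definition _ := gen_choiceMixin partN.
HB.instance Definition _ := isPointed.Build partN part0.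

Definition restr n (pi : partN) : {set {set 'I_n}} :=
  equivalence_partition (fun i j : 'I_n => pi i j) [set: 'I_n]%SET.

(* The open sets of the metric d(pi, pi') = 1 / max {n | restr n pi = restr n pi'}:
   its balls of centre pi are the sets {pi' | restr n pi' = restr n pi}. *)
Definition part_open : set (set partN) :=
  [set U | forall pi, U pi ->
     exists n, [set pi' | restr n pi' = restr n pi] `<=` U].

Definition partN_measurable : set (set partN) := <<s part_open >>.

HB.instance Definition _ := @isMeasurable.Build default_measure_display partN
  partN_measurable
  (@sigma_algebra0 _ setT part_open)
  (@sigma_algebraC _ part_open)
  (@sigma_algebra_bigcup _ setT part_open).

Definition blocksN (pi : partN) : set (set nat) :=
  range (fun i => [set j | pi i j]).

Lemma kernel_partP (S : eqType) (X : nat -> S) (r := fun i j => X i == X j) :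
  [/\ reflexive r, symmetric r & transitive r].
Proof.
rewrite /r; split=> [x|x y|y x z]; [exact: eqxx|exact: eq_sym|].
by move=> /eqP ->.
Qed.

Definition kernel_part (S : eqType) (X : nat -> S) : partN :=
  PartN (kernel_partP X).

Lemma permuteP (s : nat -> nat) (pi : partN) (r := fun i j => pi (s i) (s j)) :
  [/\ reflexive r, symmetric r & transitive r].
Proof.
case: pi @r => e [er es et] /=.
by split=> [x|x y|y x z]; [exact: er|exact: es|exact: et].
Qed.

Definition permute (s : nat -> nat) (pi : partN) : partN :=
  PartN (permuteP s pi).

Definition finitary_perm (s : nat -> nat) : Prop :=
  bijective s /\ exists N, forall n, (N <= n)%N -> s n = n.

(* its blocks are {n} and the complement of {n} *)
Definition eps1 (n : nat) : partN := kernel_part (fun k => k == n).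

(* {i, j} is the only non-singleton block *)
Definition eps2 (i j : nat) : partN :=
  kernel_part (fun k => if k == j then i else k).

Section mass_partitions.
Variable R : realType.

Record Sdown := MkSdown {
  mass :> nat -> R ;
  massP : [/\ forall i, 0 <= mass i,
              forall i, mass i.+1 <= mass i
            & (\sum_(i <oo) (mass i)%:E <= 1%:E)%E] }.

Lemma zero_massP (x := fun _ : nat => 0 : R) :
  [/\ forall i, 0 <= x i, forall i, x i.+1 <= x i
    & (\sum_(i <oo) (x i)%:E <= 1%:E)%E].
Proof. by split=> //; rewrite eseries0 // lee_fin ler01. Qed.

HB.instance Definition _ := gen_eqMixin Sdown.
HB.instance Definition _ := gen_choiceMixin Sdown.
HB.instance Definition _ := isPointed.Build Sdown (MkSdown zero_massP).

Definition coordinate_sets : set (set Sdown) :=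
  [set E | exists i A, measurable A /\ E = [set x : Sdown | A (x i)]].

Definition Sdown_measurable : set (set Sdown) := <<s coordinate_sets >>.

HB.instance Definition _ := @isMeasurable.Build default_measure_display Sdown
  Sdown_measurable
  (@sigma_algebra0 _ setT coordinate_sets)
  (@sigma_algebraC _ coordinate_sets)
  (@sigma_algebra_bigcup _ setT coordinate_sets).

Definition sum_sq (x : Sdown) : \bar R := (\sum_(i <oo) (x i ^+ 2)%:E)%E.

Definition dust (x : Sdown) : \bar R := (1%:E - \sum_(i <oo) (x i)%:E)%E.

End mass_partitions.

Section characteristics.
Variable R : realType.
Implicit Types (ck ce : R) (nuC nuD : {measure set (Sdown R) -> \bar R}).

(* [m] is mu_x, the law of the partition i ~ j <-> X_i = X_j. Only the indices
   are shifted, not the values: X i takes the value k.+1 with probability x k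
   and the value - i.+1 with probability 1 - sum x. *)
Definition paintbox_law (x : Sdown R) (m : probability partN R) : Prop :=
  exists (d : measure_display) (T : measurableType d) (P : probability T R)
         (X : nat -> T -> int),
  [/\ forall i k, measurable (X i @^-1` [set k]),
      forall n (B : nat -> set int),
        P (\bigcap_(i < n) (X i @^-1` B i)) = (\prod_(i < n) P (X i @^-1` B i))%E,
      forall i k, P (X i @^-1` [set k.+1%:Z]) = (x k)%:E,
      forall i, P (X i @^-1` [set - i.+1%:Z]) = dust x
    & forall A, measurable A ->
        m A = P [set w | A (kernel_part (fun i => X i w))] ].

Definition kappa (A : set partN) : \bar R :=
  \esum_(ij in [set ij : nat * nat | (ij.1 < ij.2)%N]) \d_(eps2 ij.1 ij.2) A.

Definition erosion (A : set partN) : \bar R :=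
  (\sum_(n <oo) \d_(eps1 n) A)%E.

Definition mu_nu (mu : Sdown R -> probability partN R)
    (nu : {measure set (Sdown R) -> \bar R}) (A : set partN) : \bar R :=
  (\int[nu]_x mu x A)%E.

Definition Cmeas (mu : Sdown R -> probability partN R) ck nuC (A : set partN)
  : \bar R := (ck%:E * kappa A + mu_nu mu nuC A)%E.

Definition Fmeas (mu : Sdown R -> probability partN R) ce nuD (A : set partN)
  : \bar R := (ce%:E * erosion A + mu_nu mu nuD A)%E.

Definition characteristics ck nuC ce nuD : Prop :=
  [/\ 0 <= ck /\ 0 <= ce,
      nuC [set x : Sdown R | forall i, x i = 0] = 0%E,
      (\int[nuC]_x sum_sq x < +oo)%E,
      nuD [set x : Sdown R | forall i, x i = (i == 0%N)%:R] = 0%E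
    & (\int[nuD]_x (1%:E - sum_sq x) < +oo)%E].

(* q n a b is the transition rate from a to b; only its values at distinct
   partitions a, b of [n] are meaningful. *)
Definition has_characteristics
    (q : forall n, {set {set 'I_n}} -> {set {set 'I_n}} -> R)
    (mu : Sdown R -> probability partN R) ck nuC ce nuD : Prop :=
  forall n (a : {set {set 'I_n}}), is_part a ->
  [/\ forall p : {set {set 'I_#|a|}}, is_part p ->
        p <> zero_part #|a| ->
        (q n a (coag p))%:E = Cmeas mu ck nuC [set pi | restr #|a| pi = p],
      forall (k : 'I_#|a|) (p : {set {set 'I_#|block a k|}}),
        is_part p ->
        p <> one_part #|block a k| ->
        (q n a (frag p))%:E =
          Fmeas mu ce nuD [set pi | restr #|block a k| pi = p]
    & forall b, is_part b -> b <> a ->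
        ~ is_coag a b -> ~ is_frag a b -> q n a b = 0].

Definition fragments_quickly ce nuD : Prop := 0 < ce \/ nuD setT = +oo%E.

Definition fragments_slowly ce nuD : Prop := ce = 0 /\ (nuD setT < +oo)%E.

End characteristics.

Section EFC.
Variable R : realType.

(* K t pi is the law at time t of the process started from pi. *)
Definition markov_semigroup (K : R -> R.-pker partN ~> partN) : Prop :=
  (forall pi A, measurable A -> K 0 pi A = \d_pi A) /\
  (forall (s t : R) pi A, 0 <= s -> 0 <= t -> measurable A ->
     K (s + t) pi A = (\int[K s pi]_pi' K t pi' A)%E).

Section process.
Context (d : measure_display) (T : measurableType d) (P : probability T R).
Variables (Pi : R -> T -> partN) (K : R -> R.-pker partN ~> partN).
Variable q : forall n, {set {set 'I_n}} -> {set {set 'I_n}} -> R.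

Definition past (s : R) : set (set T) :=
  <<s [set E | exists (u : R) A,
         [/\ 0 <= u <= s, measurable A & E = Pi u @^-1` A]] >>.

Definition markov_process : Prop :=
  [/\ forall t : R, 0 <= t -> measurable_fun setT (Pi t),
      markov_semigroup K
    & forall (s t : R) E A, 0 <= s -> 0 <= t -> past s E -> measurable A ->
        P (E `&` Pi (s + t) @^-1` A) = (\int[P]_(w in E) K t (Pi s w) A)%E].

Definition exchangeable_process : Prop :=
  forall s, finitary_perm s ->
  forall k (t : nat -> R) (A : nat -> set partN),
    (forall i, 0 <= t i) -> (forall i, measurable (A i)) ->
    P (\bigcap_(i < k) [set w | A i (permute s (Pi (t i) w))]) =
    P (\bigcap_(i < k) [set w | A i (Pi (t i) w)]).

Definition cadlag_restr : Prop :=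
  forall n w,
    (forall t : R, 0 <= t ->
       \forall s \near t^'+, restr n (Pi s w) = restr n (Pi t w)) /\
    (forall t : R, 0 < t ->
       exists a, \forall s \near t^'-, restr n (Pi s w) = a).

(* Under the semigroup K the restriction to [n] is, from every initial state, a
   Markov chain with rates q n: its transition probabilities depend on the
   current partition only through its restriction, and have derivative q n at
   time 0. *)
Definition restr_markov_chain n : Prop :=
  (forall (t : R) pi1 pi2 b, 0 <= t -> restr n pi1 = restr n pi2 ->
     K t pi1 [set pi | restr n pi = b] = K t pi2 [set pi | restr n pi = b]) /\
  (forall pi b, is_part b -> b <> restr n pi ->
     fine (K h pi [set pi' | restr n pi' = b]) / h @[h --> 0^'+]
       --> q (restr n pi) b).

Definition EFC_process : Prop :=
  [/\ markov_process, exchangeable_process, cadlag_restr,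
      forall n, restr_markov_chain n
    & forall n (a b : {set {set 'I_n}}),
        is_part a -> is_part b ->
        b <> a -> q a b <> 0 -> is_coag a b \/ is_frag a b].

End process.

Definition stationary (K : R -> R.-pker partN ~> partN)
    (rho : probability partN R) : Prop :=
  forall (t : R) A, 0 <= t -> measurable A -> (\int[rho]_pi K t pi A)%E = rho A.

End EFC.

(* Main.v *)
Require Import Defs.
From HB Require Import structures.
From mathcomp Require Import all_boot all_order all_algebra.
From mathcomp Require Import all_classical all_reals all_analysis.
From mathcomp Require Import measurable_realfun.

Set Implicit Arguments.
Unset Strict Implicit.
Unset Printing Implicit Defensive.

Import Order.TTheory GRing.Theory Num.Theory.
Import numFieldNormedType.Exports.

Local Open Scope classical_set_scope.
Local Open Scope ring_scope.

(** Why the theorem holds.  At equilibrium the flow of mass between the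
    partitions of [n] with at most K blocks and those with more blocks is the
    same in both directions; this is an instance of [balance], which only says
    that the law of the restriction to [n] is stationary for the chain with
    rates q.  A coalescence cannot increase the number of blocks and a
    fragmentation cannot decrease it, so the flow towards fewer blocks is due to
    the coalescence measure C and the opposite flow to the fragmentation measure
    F.  Both parts compare bounds on the two flows that hold for every n.

    Fast fragmentation.  To fall from m > K blocks to at most K, two of the
    first K + 1 blocks must merge, which happens at a rate at most
    C(restriction to [K + 1] is not trivial), a finite number that depends
    neither on m nor on n ([inflow_le]).  Conversely, among K blocks covering
    [n] one has at least j elements as soon as n >= K j, and this block is split
    at a rate at least F(the first j integers are separated) ([outflow_ge]),
    which is unbounded in j ([Fmeas_unbounded]): the erosion part is at least
    j ce, and the dislocation part tends to nuD(S) because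
    mu_x(the first j integers stay together) <= x_1^(j-1).  Hence
    rho(K blocks in [n]) tends to 0 as n grows ([card_prob_bound]).  A partition
    of the integers with finitely many blocks has the same number of blocks in
    [n] for all large n, so such partitions have probability 0
    ([quick_infinite]).

    Slow binary fragmentation.  If the two largest masses of x satisfy
    x_1 + x_2 = 1 for nuD-almost all x, a block can only be split into two, at
    a rate at most D = nuD(S).  So more than K blocks are reached from exactly
    K blocks only, at a rate at most K D ([outflow_le]), while K + 1 blocks coalesce at a rate at least
    ck K (K + 1) / 2, the Kingman part ([inflow_ge]).  Equality of the flows
    gives
      P(K + 1 blocks) ck (K + 1) <= 2 D P(K blocks),
    and summing over K >= J yields P(more than J blocks) <= 2 D / (ck (J + 1)),
    uniformly in n ([card_prob_tail]).  Let n and then J tend to infinity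
    ([slow_finite]).

    Rates of individual transitions are added up using the additivity of C and
    F on the events that depend on the restriction to [n].  For the parts
    mu_nu this requires that x |-> mu_x be measurable on such events
    ([measurable_paintbox]): the probability of an event is the countable sum,
    over the colourings of [n], of products of measurable functions of x. *)

(** * Operators on finite partitions *)

Lemma mem_blocks n (a : {set {set 'I_n}}) : blocks a =i a.
Proof. by move=> B; rewrite mem_sort mem_enum. Qed.

Lemma size_blocks n (a : {set {set 'I_n}}) : size (blocks a) = #|a|.
Proof. by rewrite size_sort -cardE. Qed.

Lemma mem_block n (a : {set {set 'I_n}}) (i : 'I_#|a|) : block a i \in a.
Proof. by rewrite -mem_blocks mem_nth ?size_blocks. Qed.

Lemma block_inj n (a : {set {set 'I_n}}) :
  injective (fun i : 'I_#|a| => block a i).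
Proof.
move=> i j /eqP; rewrite /block nth_uniq ?size_blocks ?sort_uniq ?enum_uniq //.
by move=> /eqP /val_inj.
Qed.

Lemma blockP n (a : {set {set 'I_n}}) B :
  B \in a -> exists i : 'I_#|a|, block a i = B.
Proof.
rewrite -mem_blocks => aB.
have lti : (index B (blocks a) < #|a|)%N by rewrite -size_blocks index_mem.
by exists (Ordinal lti); rewrite /block nth_index.
Qed.

Section Finite_partitions.
Variables (n : nat) (a : {set {set 'I_n}}).
Hypothesis pa : is_part a.

Lemma part_neq0 B : B \in a -> exists x, x \in B.
Proof.
move=> aB; apply/finset.set0Pn; apply: contraL aB => /eqP ->.
by case/and3P: pa.
Qed.

Lemma part_inj B B' x : B \in a -> B' \in a -> x \in B -> x \in B' -> B = B'.
Proof.
case/and3P: pa => _ tI _ aB aB' xB xB'.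
by rewrite -(finset.def_pblock tI aB xB) (finset.def_pblock tI aB' xB').
Qed.

Lemma part_cover x : exists2 B, B \in a & x \in B.
Proof.
case/and3P: pa => /eqP cov _ _; have : x \in finset.cover a by rewrite cov inE.
by case/finset.bigcupP => B; exists B.
Qed.

Lemma card_part_le : (#|a| <= n)%N.
Proof.
have := finset.card_partition pa; rewrite finset.cardsT card_ord => nE.
rewrite [leqRHS]nE -sum1_card; apply: leq_sum => B aB; rewrite card_gt0.
by have [x xB] := part_neq0 aB; apply/finset.set0Pn; exists x.
Qed.

(** The n block sizes are positive and sum to n, so each of them is 1. *)
Lemma card_part_max : #|a| = n -> a = zero_part n.
Proof.
move=> an.
have card1 B : B \in a -> #|B| = 1%N.
  move=> aB.
  have card_gt0 A : A \in a -> (1 <= #|A|)%N.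
    by move=> aA; rewrite card_gt0; have [x xA] := part_neq0 aA;
      apply/finset.set0Pn; exists x.
  have := finset.card_partition pa.
  rewrite finset.cardsT card_ord => nE; have := an; rewrite [RHS]nE -sum1_card.
  rewrite (bigD1 B) //= [in RHS](bigD1 B) //= => e.
  have le1 : (\sum_(i in a | i != B) 1 <= \sum_(i in a | i != B) #|i|)%N.
    by apply: leq_sum => A /andP[/card_gt0].
  have := card_gt0 _ aB; rewrite leq_eqVlt => /predU1P[//|lt1].
  by have := leq_add lt1 le1; rewrite -e add2n add1n ltnn.
apply/eqP; rewrite eqEcard; apply/andP; split; last first.
  rewrite /zero_part finset.card_imset ?card_ord ?an //.
  exact: finset.set1_inj.
apply/fintype.subsetP => B aB; have /eqP/finset.cards1P[x ->] := card1 _ aB.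
by apply/finset.imsetP; exists x.
Qed.

Lemma card_part_gt1 : (0 < n)%N -> a <> one_part n -> (1 < #|a|)%N.
Proof.
case/and3P: pa => /eqP cov _ _ n0 a1; rewrite ltnNge; apply/negP => le1.
have [x] : exists x : 'I_n, true by exists (Ordinal n0).
have [B aB xB] := part_cover x => _.
have aE : a = [set B]%SET.
  by apply/esym/eqP; rewrite eqEcard finset.sub1set aB finset.cards1.
apply: a1; rewrite aE /one_part -cov aE.
by rewrite /finset.cover finset.big_set1.
Qed.

Lemma card_part_gt0 : (0 < n)%N -> (0 < #|a|)%N.
Proof.
move=> n0; have [B aB _] := part_cover (Ordinal n0).
by rewrite card_gt0; apply/finset.set0Pn; exists B.
Qed.

(** Blocks with fewer than j elements could not cover K * j points. *)
Lemma large_block K j : (0 < K)%N -> #|a| = K -> (K * j <= n)%N ->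
  exists k : 'I_#|a|, (j <= #|block a k|)%N.
Proof.
move=> K0 aK Kjn; apply/not_existsP => small.
have := finset.card_partition pa; rewrite finset.cardsT card_ord => nE.
case: j Kjn small => [|j] Kjn small.
  by apply: (small (cast_ord (esym aK) (Ordinal K0))).
suff : (n <= K * j)%N.
  by move=> /(leq_trans Kjn); rewrite leq_pmul2l // ltnn.
rewrite [leqLHS]nE -aK -sum_nat_const; apply: leq_sum => B /blockP [k <-].
by have /negP := small k; rewrite -ltnNge ltnS.
Qed.

Let glue (B : {set 'I_#|a|}) : {set 'I_n} := (\bigcup_(i in B) block a i)%SET.

Let mem_glue (B : {set 'I_#|a|}) (i : 'I_#|a|) x :
  x \in block a i -> (x \in glue B) = (i \in B).
Proof.
move=> xi; apply/finset.bigcupP/idP => [[j jB xj]|iB]; last by exists i.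
by rewrite (block_inj (part_inj (mem_block i) (mem_block j) xi xj)).
Qed.

Let glue_inj : injective glue.
Proof.
move=> B B' BB'; apply/finset.setP => i.
by have [x xi] := part_neq0 (mem_block i); rewrite -!(mem_glue _ xi) BB'.
Qed.

Lemma coag_inj : injective (@coag n a).
Proof. exact: finset.imset_inj glue_inj. Qed.

Lemma card_coag p : #|coag (a := a) p| = #|p|.
Proof. exact: finset.card_imset glue_inj. Qed.

Lemma is_part_coag p : is_part p -> is_part (coag (a := a) p).
Proof.
move=> pp; apply/and3P; split.
- apply/eqP/finset.setP => x; rewrite inE.
  have [B aB xB] := part_cover x; have [i iB] := blockP aB.
  case/and3P: pp => /eqP cov _ _.
  have : i \in finset.cover p by rewrite cov inE.
  case/finset.bigcupP => C pC iC; apply/finset.bigcupP; exists (glue C).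
    by apply/finset.imsetP; exists C.
  by rewrite (mem_glue _ (i := i)) ?iB.
- apply/finset.trivIsetP => C C' /finset.imsetP[B pB ->].
  move=> /finset.imsetP[B' pB' ->]; rewrite (inj_eq glue_inj) => BB'.
  case/and3P: pp => _ /finset.trivIsetP tI _.
  rewrite -finset.setI_eq0; apply/eqP/finset.setP => x; rewrite !inE.
  have [A aA xA] := part_cover x; have [i iA] := blockP aA.
  rewrite -iA in xA; rewrite !(mem_glue _ xA).
  have := tI _ _ pB pB' BB'; rewrite -finset.setI_eq0 => /eqP/finset.setP/(_ i).
  by rewrite !inE.
- apply/negP => /finset.imsetP[B pB /esym B0].
  case/and3P: pp => _ _ /negP; apply; suff <- : B = finset.set0 by [].
  apply/finset.setP => i; have [x xi] := part_neq0 (mem_block i).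
  by rewrite -(mem_glue _ xi) [glue B]B0 !inE.
Qed.

Section Fragmentation.
Variable k : 'I_#|a|.

Let lift (A : {set 'I_#|block a k|}) : {set 'I_n} :=
  [set enum_val i | i in A]%SET.

Let lift_inj : injective lift.
Proof. exact: finset.imset_inj (@enum_val_inj _ _). Qed.

Let lift_sub A x : x \in lift A -> x \in block a k.
Proof. by case/finset.imsetP => i _ ->; apply: enum_valP. Qed.

Section Pieces.
Variable p : {set {set 'I_#|block a k|}}.
Hypothesis pp : is_part p.

Let lift_neq0 A : A \in p -> exists x, x \in lift A.
Proof.
move=> pA; have /finset.set0Pn[i iA] : A != finset.set0.
  by apply: contraL pA => /eqP ->; case/and3P: pp.
by exists (enum_val i); apply: finset.imset_f.
Qed.

Let lift_new A : A \in p -> lift A \notin (a :\ block a k)%SET.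
Proof.
move=> pA; rewrite !inE negb_and; have [x xA] := lift_neq0 pA.
have [->//|/= lA] := eqVneq (lift A) (block a k).
apply: contra_neqN lA => aA.
exact: part_inj aA (mem_block k) xA (lift_sub xA).
Qed.

Let disjoint_pieces :
  ((a :\ block a k) :&: [set lift A | A in p] = finset.set0)%SET.
Proof.
apply/finset.setP => B; rewrite !inE; apply/negbTE/negP.
case/andP => Ba /finset.imsetP[A pA BA]; move: Ba.
by rewrite -finset.in_setD1 BA; apply/negP/lift_new.
Qed.

Lemma card_frag : (#|frag p|.+1 = #|a| + #|p|)%N.
Proof.
rewrite /frag finset.cardsU disjoint_pieces finset.cards0 subn0.
rewrite (finset.card_imset _ lift_inj) -addSn; congr (_ + _)%N.
by have := finset.cardsD1 (block a k) a; rewrite mem_block add1n => <-.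
Qed.

Lemma frag_pieces : ([set lift A | A in p] = frag p :\: (a :\ block a k))%SET.
Proof.
rewrite /frag finset.setDUl finset.setDv finset.set0U.
apply/esym/finset.setDidPl.
by rewrite -finset.setI_eq0 finset.setIC disjoint_pieces.
Qed.

Lemma is_part_frag : is_part (frag p).
Proof.
apply/and3P; split.
- apply/eqP/finset.setP => x; rewrite inE; have [B aB xB] := part_cover x.
  apply/finset.bigcupP; have [Bk|Bk] := eqVneq B (block a k); last first.
    by exists B => //; rewrite !inE Bk aB.
  rewrite Bk in xB; case/and3P: pp => /eqP cov _ _.
  have : enum_rank_in xB x \in finset.cover p by rewrite cov inE.
  case/finset.bigcupP => C pC iC; exists (lift C).
    by rewrite !inE; apply/orP; right; apply: finset.imset_f.
  by rewrite -(enum_rankK_in xB xB); apply: finset.imset_f.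
- have lift_disj B A x : B \in (a :\ block a k)%SET -> x \in B ->
      x \in lift A -> False.
    rewrite !inE => /andP[Bk aB] xB xA; case/negP: Bk; apply/eqP.
    exact: part_inj aB (mem_block k) xB (lift_sub xA).
  apply/finset.trivIsetP => B B' fB fB' BB'.
  rewrite -finset.setI_eq0; apply/eqP/finset.setP => x; rewrite !inE.
  apply/negbTE/negP => /andP[xB xB'].
  case/finset.setUP: fB; case/finset.setUP: fB'.
  + rewrite !inE => /andP[_ aB'] /andP[_ aB]; case/negP: BB'; apply/eqP.
    exact: part_inj xB xB'.
  + case/finset.imsetP => A pA B'A aB.
    by apply: (lift_disj _ A _ aB xB); rewrite /lift -B'A.
  + move=> aB' /finset.imsetP[A pA BA].
    by apply: (lift_disj _ A _ aB' xB'); rewrite /lift -BA.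
  + case/finset.imsetP => A' pA' B'A' /finset.imsetP[A pA BA].
    rewrite B'A' in xB'; rewrite BA in xB.
    case/finset.imsetP: xB => i iA xi; case/finset.imsetP: xB' => j jA xj.
    have ij : i = j by apply: enum_val_inj; rewrite -xi -xj.
    case/negP: BB'; rewrite BA B'A'; apply/eqP; congr lift.
    case/and3P: pp => _ tI _.
    rewrite -ij in jA.
    by rewrite -(finset.def_pblock tI pA iA) (finset.def_pblock tI pA' jA).
- rewrite !inE negb_or negb_and; apply/andP; split.
    by case/and3P: pa => _ _ ->; rewrite orbT.
  apply/negP => /finset.imsetP[A pA A0]; have [x] := lift_neq0 pA.
  by rewrite /lift -A0 inE.
Qed.

End Pieces.

(** The pieces of the split block are the blocks of the new partition that are
    not blocks of the old one. *)
Lemma frag_inj p p' : is_part p -> is_part p' ->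
  frag (a := a) (k := k) p = frag p' -> p = p'.
Proof.
move=> pp pp' e; apply: (finset.imset_inj lift_inj).
by rewrite !frag_pieces // e.
Qed.

End Fragmentation.
End Finite_partitions.

Lemma is_part_zero n : is_part (zero_part n).
Proof.
apply/and3P; split.
- apply/eqP/finset.setP => x; rewrite inE; apply/finset.bigcupP.
  by exists [set x]%SET; [apply: finset.imset_f|rewrite inE].
- apply/finset.trivIsetP => _ _ /finset.imsetP[x _ ->] /finset.imsetP[y _ ->].
  by rewrite finset.disjoints1 inE; apply: contra => /eqP ->.
- by apply/negP => /finset.imsetP[x _ /finset.setP/(_ x)]; rewrite !inE eqxx.
Qed.

Lemma card_zero_part n : #|zero_part n| = n.
Proof. by rewrite finset.card_imset ?card_ord //; apply: finset.set1_inj. Qed.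

Lemma coag_zero n (a : {set {set 'I_n}}) : coag (zero_part #|a|) = a.
Proof.
apply/finset.setP => B; apply/finset.imsetP/idP.
  by case=> B' /finset.imsetP[i _ ->] ->; rewrite finset.big_set1 mem_block.
move=> /blockP[i <-]; exists [set i]%SET; first exact: finset.imset_f.
by rewrite finset.big_set1.
Qed.

Lemma frag_one n (a : {set {set 'I_n}}) (k : 'I_#|a|) :
  frag (k := k) (one_part #|block a k|) = a.
Proof.
rewrite /frag /one_part finset.imset_set1.
suff -> : [set enum_val i | i in [set: 'I_#|block a k|]]%SET = block a k.
  by rewrite finset.setUC finset.setD1K ?mem_block.
apply/finset.setP => x; apply/finset.imsetP/idP => [[i _ ->]|xk].
  exact: enum_valP.
by exists (enum_rank_in xk x); rewrite ?inE ?enum_rankK_in.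
Qed.

(** * Comparing sums of rates *)

Lemma sum_inj_le (R : numDomainType) (I J : finType) (f : I -> J) (P : pred I)
    (Q : pred J) (g : J -> R) :
    {in P &, injective f} -> (forall i, P i -> Q (f i)) ->
    (forall j, Q j -> 0 <= g j) ->
  \sum_(i | P i) g (f i) <= \sum_(j | Q j) g j.
Proof.
move=> inj PQ g0; rewrite -(finset.big_imset (h := f) (A := P)) //=.
rewrite [leRHS](bigID (fun j => j \in f @: P)%SET) /= -[leLHS]addr0.
apply: lerD; last by apply: sumr_ge0 => j /andP[/g0].
rewrite le_eqVlt; apply/orP; left; apply/eqP; apply: eq_bigl => j.
apply/idP/andP => [fj|[]//]; split=> //.
by case/finset.imsetP: fj => i Pi ->; apply: PQ.
Qed.

Lemma sum_surj_le (R : numDomainType) (I J : finType) (f : I -> J) (P : pred I)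
    (Q : pred J) (g : J -> R) :
    (forall i, P i -> 0 <= g (f i)) ->
    (forall j, Q j -> g j != 0 -> exists2 i, P i & f i = j) ->
  \sum_(j | Q j) g j <= \sum_(i | P i) g (f i).
Proof.
move=> g0 surj; rewrite [leRHS](partition_big f predT) //= big_mkcond.
apply: ler_sum => j _; have fib0 : 0 <= \sum_(i | P i && (f i == j)) g (f i).
  by apply: sumr_ge0 => i /andP[/g0].
case: ifPn => // Qj; have [->//|gj] := eqVneq (g j) 0.
have [i Pi fij] := surj _ Qj gj.
rewrite (bigD1 i) /=; last by rewrite Pi fij eqxx.
by rewrite fij lerDl; apply: sumr_ge0 => i' /andP[/andP[/g0]].
Qed.

(** * Restrictions of a partition of the integers *)

Lemma restr_equiv n (pi : partN) :
  {in [set: 'I_n]%SET & &, equivalence_rel (fun i j : 'I_n => pi i j)}.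
Proof.
case: pi => e [er es et] x y z _ _ _ /=; split; first exact: er.
move=> xy; apply/idP/idP => [xz|yz]; last exact: et xy yz.
by apply: et xz; rewrite es.
Qed.

Lemma is_part_restr n pi : is_part (restr n pi).
Proof. exact: finset.equivalence_partitionP (@restr_equiv n pi). Qed.

Lemma class_restr n (pi : partN) (i : 'I_n) :
  [set j : 'I_n | pi i j]%SET \in restr n pi.
Proof.
apply/finset.imsetP; exists i; first by rewrite inE.
by apply/finset.setP => j; rewrite !inE.
Qed.

Lemma mem_restrP n (pi : partN) B :
  B \in restr n pi -> exists i : 'I_n, B = [set j : 'I_n | pi i j]%SET.
Proof.
rewrite /restr => /finset.imsetP[i _ ->]; exists i.
by apply/finset.setP => j; rewrite !inE.
Qed.

(** Colouring each point of [n] with its block gives back the partition; the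
    points outside of [n] get the extra colour set0. *)
Lemma restr_surj n (a : {set {set 'I_n}}) :
  is_part a -> exists pi, restr n pi = a.
Proof.
move=> pa; pose X i := if insub i is Some j then finset.pblock a j
  else finset.set0 : {set 'I_n}.
exists (kernel_part X); rewrite -[RHS](finset.preim_partition_pblock pa).
rewrite /restr /finset.preim_partition /finset.equivalence_partition.
apply: finset.eq_imset => i; apply/finset.setP => j.
by rewrite !inE /= /X !valK.
Qed.

Lemma measurable_restr n (Q : set {set {set 'I_n}}) :
  measurable [set pi | Q (restr n pi)].
Proof. by apply: sub_sigma_algebra => pi Qpi; exists n => pi' /= ->. Qed.

Lemma restr_eqE n (a : {set {set 'I_n}}) :
  [set pi | restr n pi = a] = [set pi | restr n pi == a].
Proof. by apply/seteqP; split=> pi /= /eqP. Qed.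

Lemma restr_zeroP n (pi : partN) :
  restr n pi = zero_part n <->
  (forall i j, (i < n)%N -> (j < n)%N -> pi i j -> i = j).
Proof.
split=> [r0 i j ltin ltjn piij|inj].
  have := class_restr pi (Ordinal ltin); rewrite r0.
  case/finset.imsetP => x _ /finset.setP e.
  have := e (Ordinal ltin); have := e (Ordinal ltjn); rewrite !inE /= piij.
  case: (part_relP pi) => -> _ _.
  by move=> /esym/eqP /(congr1 val) /= -> /esym/eqP /(congr1 val) /= ->.
have cl1 (i : 'I_n) : [set j : 'I_n | pi i j]%SET = [set i]%SET.
  apply/finset.setP => j; rewrite !inE.
  apply/idP/eqP => [piij|->]; last by case: (part_relP pi) => ->.
  exact/ord_inj/esym/(inj _ _ (ltn_ord i) (ltn_ord j) piij).
apply/finset.setP => B; apply/idP/finset.imsetP => [|[i _ ->]].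
  by case/mem_restrP => i ->; exists i => //; rewrite cl1.
by rewrite -cl1; apply: class_restr.
Qed.

Lemma restr_oneP n (pi : partN) : (0 < n)%N ->
  restr n pi = one_part n <->
  (forall i j, (i < n)%N -> (j < n)%N -> pi i j).
Proof.
move=> n0; split=> [r1 i j ltin ltjn|all1].
  have := class_restr pi (Ordinal ltin); rewrite r1 inE => /eqP/finset.setP.
  by move=> /(_ (Ordinal ltjn)); rewrite !inE.
apply/finset.setP => B; rewrite [in RHS]inE; apply/idP/eqP => [|->].
  case/mem_restrP => i ->; apply/finset.setP => j; rewrite !inE.
  exact: all1.
have <- : [set j : 'I_n | pi (Ordinal n0) j]%SET = [set: 'I_n]%SET.
  by apply/finset.setP => j; rewrite !inE all1.
exact: class_restr.
Qed.

(** The leaders, i.e. the least elements of the blocks, count the blocks of all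
    restrictions at once. *)
Definition leader (pi : partN) (i : nat) : bool :=
  [forall j : 'I_i, ~~ pi i j].

Lemma exists_leader (pi : partN) i :
  exists j, [/\ (j <= i)%N, leader pi j & pi i j].
Proof.
have [er es et] := part_relP pi.
elim/ltn_ind: i => i IH.
have [li|/forallPn[j /negPn pij]] := boolP (leader pi i).
  by exists i; split.
have [k [lekj lk pjk]] := IH _ (ltn_ord j).
by exists k; split=> //; [exact: leq_trans lekj (ltnW _)|exact: et pij pjk].
Qed.

Lemma leader_inj (pi : partN) i j :
  leader pi i -> leader pi j -> pi i j -> i = j.
Proof.
have [er es et] := part_relP pi.
move=> /forallP li /forallP lj pij; case: (ltngtP i j) => // lt.
  by have := lj (Ordinal lt); rewrite es pij.
by have := li (Ordinal lt); rewrite pij.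
Qed.

Lemma card_restr n (pi : partN) : #|restr n pi| = (\sum_(i < n) leader pi i)%N.
Proof.
have [er es et] := part_relP pi.
rewrite -big_mkcond sum1dep_card.
pose cl (i : 'I_n) := [set j : 'I_n | pi i j]%SET.
rewrite -(finset.card_in_imset (f := cl)); last first.
  move=> i j; rewrite !inE => li lj /finset.setP/(_ j); rewrite !inE er => pij.
  exact/val_inj/(leader_inj li lj).
apply: eq_card => B.
apply/idP/finset.imsetP => [|[i _ ->]]; last exact: class_restr.
case/mem_restrP => i ->; have [j [leji lj pij]] := exists_leader pi i.
have ltjn := leq_ltn_trans leji (ltn_ord i).
exists (Ordinal ltjn); rewrite ?inE //; apply/finset.setP => k; rewrite !inE /=.
by apply/idP/idP; apply: et => //; rewrite es.
Qed.

Lemma card_restr_mono (pi : partN) :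
  {homo (fun n => #|restr n pi|) : m n / (m <= n)%N}.
Proof.
apply: homo_leq => [//|n m p|n]; first exact: leq_trans.
by rewrite !card_restr big_ord_recr leq_addr.
Qed.

(** Each block has exactly one leader. *)
Lemma finite_blocksP (pi : partN) :
  finite_set (blocksN pi) <-> exists N, forall i, (N <= i)%N -> ~~ leader pi i.
Proof.
have [er es et] := part_relP pi; split=> [fin|[N noN]].
  pose ld (B : set nat) := xget 0%N [set i | leader pi i /\ B i].
  have : finite_set [set i | leader pi i].
    apply: sub_finite_set (finite_image ld fin) => i /= li.
    exists [set j | pi i j]; first by exists i.
    rewrite /ld; apply: xget_unique => [|j [lj pij]] /=.
      by split=> //; exact: er.
    exact/esym/(leader_inj li lj pij).
  move=> /finite_seqP[s sE]; exists (\max_(i <- s) i).+1 => i ltsi.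
  apply/negP => li; have : [set` s] i by rewrite -sE.
  by move=> /= si; move: ltsi; rewrite ltnNge (@leq_bigmax_seq _ _ predT id).
apply: sub_finite_set (finite_image (fun i => [set j | pi i j]) (finite_II N)).
move=> _ [i _ <-]; have [j [_ lj pij]] := exists_leader pi i.
exists j; first by rewrite /= ltnNge; apply/negP => /noN; rewrite lj.
by apply/seteqP; split=> k /=; apply: et; rewrite // es.
Qed.

Lemma card_restr_stationary (pi : partN) : finite_set (blocksN pi) ->
  exists N, forall n, (N <= n)%N -> #|restr n pi| = #|restr N pi|.
Proof.
move=> /finite_blocksP[N noN]; exists N => n.
elim: n => [|n IH]; first by rewrite leqn0 => /eqP ->.
rewrite leq_eqVlt => /predU1P[->//|leNn].
rewrite -(IH leNn) [LHS]card_restr big_ord_recr -card_restr /=.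
by rewrite (negbTE (noN _ leNn)) addn0.
Qed.

Lemma card_restr_unbounded (pi : partN) : ~ finite_set (blocksN pi) ->
  forall J, exists n, (J < #|restr n pi|)%N.
Proof.
move=> inf; elim=> [|J [n ltJn]].
  exists 1%N; rewrite card_restr big_ord1.
  by have -> // : leader pi (ord0 : 'I_1) = true by apply/forallP => -[].
have [i [leni li]] : exists i, (n <= i)%N /\ leader pi i.
  apply/not_existsP => no; apply/inf/finite_blocksP; exists n => i leni.
  by apply/negP => li; apply: (no i).
exists i.+1; rewrite card_restr big_ord_recr -card_restr /= li addn1 ltnS.
exact: leq_trans ltJn (card_restr_mono pi leni).
Qed.

Lemma infinite_blocksE : [set pi : partN | ~ finite_set (blocksN pi)] =
  \bigcap_J \bigcup_n [set pi | (J < #|restr n pi|)%N].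
Proof.
apply/seteqP; split=> pi /= => [inf J _|unb fin].
  by have [n] := card_restr_unbounded inf J; exists n.
have [N stat] := card_restr_stationary fin.
have [n _ /=] := unb #|restr N pi| I; apply/negP; rewrite -leqNgt.
have [leNn|/ltnW lenN] := leqP N n; first by rewrite stat.
exact: card_restr_mono.
Qed.

Lemma measurable_finite_blocks :
  measurable [set pi : partN | finite_set (blocksN pi)].
Proof.
rewrite -[X in measurable X]setCK; apply: measurableC.
rewrite [X in measurable X](_ : _ =
  [set pi : partN | ~ finite_set (blocksN pi)]) // infinite_blocksE.
apply: bigcap_measurableType => J _; apply: bigcupT_measurable => n.
exact: (measurable_restr (fun a => J < #|a|)%N).
Qed.

(** * Events that depend on a restriction *)

Lemma measure_finite_image d (T : measurableType d) (R : realType)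
    (m : {measure set T -> \bar R}) (F : finType) (f : T -> F) (Q : pred F) :
    (forall a, measurable [set x | f x = a]) ->
  m [set x | Q (f x)] = (\sum_(a | Q a) m [set x | f x = a])%E.
Proof.
move=> mf; rewrite -big_enum.
have -> : [set x | Q (f x)] = [set x | f x \in enum Q].
  by apply/seteqP; split=> x /=; rewrite mem_enum.
elim: (enum Q) (enum_uniq Q) => [|a s IH] /=.
  by rewrite big_nil (_ : [set _ | _] = set0) ?measure0 //; apply/seteqP; split.
case/andP => as_ us; rewrite big_cons -IH //.
have ms : measurable [set x | f x \in s].
  elim: s {as_ us IH} => [|b s IH].
    by rewrite (_ : [set _ | _] = set0) //; apply/seteqP; split.
  rewrite (_ : [set _ | _] = [set x | f x = b] `|` [set x | f x \in s]).
    exact: measurableU.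
  apply/seteqP; split=> x /=; rewrite inE; first by case/predU1P; [left|right].
  by case=> [->|->]; rewrite ?eqxx ?orbT.
rewrite -measureU //.
  congr (m _); apply/seteqP; split=> x /=; rewrite inE.
    by case/predU1P; [left|right].
  by case=> [->|->]; rewrite ?eqxx ?orbT.
by apply/seteqP; split=> x //= -[->]; rewrite (negbTE as_).
Qed.

Lemma measure_restr (R : realType) (m : {measure set partN -> \bar R}) n
    (Q : pred {set {set 'I_n}}) :
  m [set pi | Q (restr n pi)] =
  (\sum_(a | is_part a && Q a) m [set pi | restr n pi = a])%E.
Proof.
rewrite (measure_finite_image _ Q) => [|a]; last first.
  exact: (measurable_restr [set a]).
rewrite big_mkcond [RHS]big_mkcond; apply: eq_bigr => a _.
have [pa|/negbTE npa] := boolP (is_part a); first by [].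
rewrite (_ : [set _ | _] = set0) ?measure0 ?if_same //.
by apply/seteqP; split=> pi //= e; move: npa; rewrite -e is_part_restr.
Qed.

Lemma le_measure_restr (R : realType) (m : {measure set partN -> \bar R}) n
    (Q : pred {set {set 'I_n}}) k (Q' : pred {set {set 'I_k}}) :
    (forall pi, Q (restr n pi) -> Q' (restr k pi)) ->
  (m [set pi | Q (restr n pi)] <= m [set pi | Q' (restr k pi)])%E.
Proof.
move=> QQ'; apply: le_measure => //; rewrite inE.
  exact: (measurable_restr Q).
exact: (measurable_restr Q').
Qed.

(** * The balance equations of the stationary law *)

Lemma integral_restr (R : realType) (m : {measure set partN -> \bar R}) n
    (g : {set {set 'I_n}} -> R) : (forall a, 0 <= g a) ->
  (\int[m]_pi (g (restr n pi))%:E =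
   \sum_(a | is_part a) (g a)%:E * m [set pi | restr n pi = a])%E.
Proof.
move=> g0.
have mr (a : {set {set 'I_n}}) : measurable [set pi | restr n pi = a].
  exact: (measurable_restr [set a]).
rewrite [RHS](_ : _ =
    \sum_a (g a)%:E * m [set pi | restr n pi = a])%E; last first.
  rewrite big_mkcond; apply: eq_bigr => a _; case: ifPn => // /negbTE npa.
  rewrite (_ : [set _ | _] = set0) ?measure0 ?mule0 //.
  by apply/seteqP; split=> pi //= e; move: npa; rewrite -e is_part_restr.
transitivity (\int[m]_pi
    \sum_a (g a)%:E * (\1_[set pi | restr n pi = a] pi)%:E)%E.
  apply: eq_integral => pi _; rewrite (bigD1 (restr n pi)) //= big1.
    by rewrite indicE mem_set // mule1 adde0.
  move=> a /eqP ra; rewrite indicE memNset ?mule0 // => e.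
  by apply: ra; rewrite e.
have m1 a : measurable_fun setT
    (EFin \o (\1_[set pi | restr n pi = a] : partN -> R)).
  by apply/measurable_EFinP; apply: measurable_indic; exact: mr.
rewrite ge0_integral_sum //.
- apply: eq_bigr => a _; rewrite ge0_integralZl_EFin //.
    by rewrite integral_indic ?setIT //; apply: mr.
  exact: m1.
- by move=> a; apply: emeasurable_funM; [exact: measurable_cst|exact: m1].
- by move=> a pi _; rewrite mule_ge0 // lee_fin // indicE.
Qed.

Definition restr_prob (R : realType) (m : set partN -> \bar R) n
  (a : {set {set 'I_n}}) : R := fine (m [set pi | restr n pi = a]).

Section Restr_prob.
Variables (R : realType) (m : {measure set partN -> \bar R}).
Hypothesis m1 : m setT = 1%E.

Lemma restr_prob_ge0 n (a : {set {set 'I_n}}) : 0 <= restr_prob m a.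
Proof. exact/fine_ge0/measure_ge0. Qed.

Lemma restr_probK n (a : {set {set 'I_n}}) :
  (restr_prob m a)%:E = m [set pi | restr n pi = a].
Proof.
rewrite fineK // ge0_fin_numE // (@le_lt_trans _ _ (m setT)) //; last first.
  by rewrite m1 ltry.
by apply: le_measure; rewrite ?inE //; apply: (measurable_restr [set a]).
Qed.

Lemma restr_probE n (Q : pred {set {set 'I_n}}) :
  m [set pi | Q (restr n pi)] =
  (\sum_(a | is_part a && Q a) restr_prob m a)%:E.
Proof.
by rewrite measure_restr -sumEFin; apply: eq_bigr => a _; rewrite restr_probK.
Qed.

Lemma sum_restr_prob n :
  \sum_(a : {set {set 'I_n}} | is_part a) restr_prob m a = 1.
Proof.
apply: EFin_inj; rewrite -[RHS]m1.
rewrite (_ : setT = [set pi | predT (restr n pi)]); last first.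
  by apply/seteqP; split.
by rewrite restr_probE; congr EFin; apply: eq_bigl => a; rewrite andbT.
Qed.

End Restr_prob.

(** Stationarity at a small time h, after cancelling the mass that stays in the
    set of states Q, dividing by h and letting h tend to 0. *)
Lemma balance (R : realType) (K : R -> R.-pker partN ~> partN)
    (q : forall n, {set {set 'I_n}} -> {set {set 'I_n}} -> R)
    (rho : probability partN R) n (Q : pred {set {set 'I_n}}) :
    restr_markov_chain K q n -> stationary K rho ->
  \sum_(a | is_part a && Q a) restr_prob rho a *
    (\sum_(b | is_part b && ~~ Q b) q n a b) =
  \sum_(a | is_part a && ~~ Q a) restr_prob rho a *
    (\sum_(b | is_part b && Q b) q n a b).
Proof.
case=> Kmarkov Kder Kstat.
have /choice[ext extP] : forall a : {set {set 'I_n}}, exists pi,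
    is_part a -> restr n pi = a.
  move=> a; have [/restr_surj[pi <-]|_] := boolP (is_part a).
    by exists pi.
  by exists part0.
(* for t >= 0 and partitions a, k t a b is the same for all extensions of a *)
pose k t (a b : {set {set 'I_n}}) := restr_prob (K t (ext a)) b.
have r0 a : 0 <= restr_prob rho a := restr_prob_ge0 rho a.
have rE t b : 0 <= t ->
    restr_prob rho b = \sum_(a | is_part a) restr_prob rho a * k t a b.
  move=> t0; apply: EFin_inj.
  rewrite (restr_probK (probability_setT rho)) -[LHS](Kstat t) //; last first.
    exact: (measurable_restr [set b]).
  transitivity (\int[rho]_pi (k t (restr n pi) b)%:E)%E.
    apply: eq_integral => pi _; rewrite /k restr_probK ?prob_kernel //.
    by apply: Kmarkov => //; rewrite extP ?is_part_restr.
  rewrite (integral_restr rho (g := fun a => k t a b)); last first.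
    by move=> a; apply: restr_prob_ge0.
  rewrite -sumEFin; apply: eq_bigr => a _; rewrite EFinM muleC; congr (_ * _)%E.
  by rewrite (restr_probK (probability_setT rho)).
have flux t : 0 <= t ->
    \sum_(a | is_part a && Q a) restr_prob rho a *
      (\sum_(b | is_part b && ~~ Q b) k t a b) =
    \sum_(a | is_part a && ~~ Q a) restr_prob rho a *
      (\sum_(b | is_part b && Q b) k t a b).
  move=> t0.
  have inQ : \sum_(b | is_part b && Q b) restr_prob rho b =
      \sum_(a | is_part a) restr_prob rho a *
        (\sum_(b | is_part b && Q b) k t a b).
    under eq_bigr do rewrite (rE t) //.
    by rewrite exchange_big /=; apply: eq_bigr => a _; rewrite mulr_sumr.
  have tot a : \sum_(b | is_part b && Q b) k t a b +
      \sum_(b | is_part b && ~~ Q b) k t a b = 1.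
    by rewrite -bigID /= sum_restr_prob ?prob_kernel.
  have : \sum_(a | is_part a && Q a) restr_prob rho a =
    \sum_(a | is_part a && Q a) restr_prob rho a *
      (\sum_(b | is_part b && Q b) k t a b) +
    \sum_(a | is_part a && Q a) restr_prob rho a *
      (\sum_(b | is_part b && ~~ Q b) k t a b).
    rewrite -big_split /=; apply: eq_bigr => a _.
    by rewrite -mulrDr tot mulr1.
  rewrite inQ (bigID Q) /= => e.
  by apply: (addrI _ (esym e)).
(* the derivative exists off the diagonal only, whence the disjointness below *)
have der a b : is_part a -> is_part b -> a <> b ->
    k h a b / h @[h --> 0^'+] --> q n a b.
  move=> pa pb ab; have := Kder (ext a) b; rewrite extP //; apply=> //.
  by move=> ba; apply: ab.
have lim (Q1 Q2 : pred {set {set 'I_n}}) : (forall a, Q1 a -> ~~ Q2 a) ->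
    (\sum_(a | is_part a && Q1 a) restr_prob rho a *
      (\sum_(b | is_part b && Q2 b) k h a b)) / h @[h --> 0^'+] -->
    \sum_(a | is_part a && Q1 a) restr_prob rho a *
      (\sum_(b | is_part b && Q2 b) q n a b).
  move=> Q12.
  under eq_cvg => h.
    rewrite mulr_suml; under eq_bigr do rewrite -mulrA mulr_suml.
    over.
  apply: cvg_big; first exact: add_continuous.
  move=> a /andP[pa Qa]; apply: cvgMr.
  apply: cvg_big; first exact: add_continuous.
  move=> b /andP[pb Qb]; apply: der => // ab.
  by have := Q12 _ Qa; rewrite ab Qb.
have := lim Q (predC Q) (fun a Qa => introN idP (fun nQ => negP nQ Qa)).
have := lim (predC Q) Q (fun a nQ => nQ).
move=> limin limout; apply: (cvg_unique _ limout) => //.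
apply: cvg_trans limin; apply: near_eq_cvg; near=> h.
by rewrite /= flux.
Unshelve. all: by end_near. Qed.

(** * Paintboxes *)

Lemma card_restr_kernel (S : eqType) (X : nat -> S) (s : seq S) n :
  (forall i, (i < n)%N -> X i \in s) ->
  (#|restr n (kernel_part X)| <= size s)%N.
Proof.
move=> Xs; pose F c := [set j : 'I_n | c == X j]%SET.
rewrite cardE -(size_map F s); apply: uniq_leq_size; first exact: enum_uniq.
move=> B; rewrite mem_enum => /mem_restrP[i ->]; apply/mapP.
by exists (X i); first exact: Xs.
Qed.

Lemma restr_kernel (S : eqType) (X Y : nat -> S) n :
  (forall i, (i < n)%N -> X i = Y i) ->
  restr n (kernel_part X) = restr n (kernel_part Y).
Proof.
move=> XY; rewrite /restr /finset.equivalence_partition.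
apply: finset.eq_imset => i; apply/finset.setP => j; rewrite !inE /=.
by rewrite !XY.
Qed.

Section Mass_partitions.
Variable R : realType.
Implicit Type x : Sdown R.

Lemma mass_ge0 x i : 0 <= x i.
Proof. by case: (massP x). Qed.

Lemma mass_le0 x i : x i <= x 0%N.
Proof. by elim: i => // i; apply: le_trans; case: (massP x). Qed.

Lemma sum_mass_le1 x : (\sum_(i <oo) (x i)%:E <= 1%:E)%E.
Proof. by case: (massP x). Qed.

Lemma sum_mass_ge0 x : (0 <= \sum_(i <oo) (x i)%:E)%E.
Proof. by apply: nneseries_ge0 => i _ _; rewrite lee_fin mass_ge0. Qed.

Lemma sum_mass_fin x : (\sum_(i <oo) (x i)%:E)%E \is a fin_num.
Proof.
by rewrite ge0_fin_numE ?sum_mass_ge0 // (le_lt_trans (sum_mass_le1 x)) ?ltry.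
Qed.

Lemma dust_ge0 x : (0 <= dust x)%E.
Proof. by rewrite sube_ge0 ?sum_mass_le1 // sum_mass_fin. Qed.

Lemma mass0_le1 x : x 0%N <= 1.
Proof.
rewrite -lee_fin; apply: le_trans (sum_mass_le1 x).
have := @nneseries_lim_ge R (fun i => (x i)%:E) predT 0%N 1%N.
by rewrite big_nat1; apply=> i _ _; rewrite lee_fin mass_ge0.
Qed.

Lemma measurable_mass i : measurable_fun setT (fun x => x i).
Proof.
move=> _ A mA; rewrite setTI; apply: sub_sigma_algebra.
by exists i, A.
Qed.

Lemma measurable_dust : measurable_fun setT (@dust R).
Proof.
apply: emeasurable_funB; first exact: measurable_cst.
apply: (ge0_emeasurable_sum (P := predT)) => [k x _ _|k _].
  by rewrite lee_fin mass_ge0.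
by apply/measurable_EFinP; exact: measurable_mass.
Qed.

(** The law of the i-th colour of a paintbox: a positive colour k has the mass
    of the atom k, the only negative colour of non-zero mass is the one reserved
    for i, and the colour 0 does not occur. *)
Definition colour_prob x (i : nat) (k : int) : \bar R :=
  match k with
  | Posz 0 => 0
  | Posz k'.+1 => (x k')%:E
  | Negz j => if j == i then dust x else 0
  end%E.

Lemma colour_prob_ge0 x i k : (0 <= colour_prob x i k)%E.
Proof.
case: k => [[|k]|j] //=; first by rewrite lee_fin mass_ge0.
by case: ifP => // _; apply: dust_ge0.
Qed.

Lemma measurable_colour_prob i k :
  measurable_fun setT (fun x => colour_prob x i k).
Proof.
case: k => [[|k]|j] /=; first exact: measurable_cst.
  by apply/measurable_EFinP; exact: measurable_mass.
by case: eqP => _; [exact: measurable_dust|exact: measurable_cst].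
Qed.

(** The term of index l of the probability of Q as a countable sum over the
    colourings of [n], which are enumerated by their codes; an integer that
    codes no colouring contributes 0. *)
Definition colouring_prob x n (Q : pred {set {set 'I_n}}) (l : nat) : \bar R :=
  (if @pickle_inv (n.-tuple int) l is Some s then
    if Q (restr n (kernel_part (nth 0%R s)))
    then \prod_(i < n) colour_prob x i (nth 0%R s i) else 0
  else 0)%E.

Lemma colouring_prob_ge0 x n Q l : (0 <= @colouring_prob x n Q l)%E.
Proof.
rewrite /colouring_prob; case: pickle_inv => [s|//]; case: ifP => // _.
by apply: prode_ge0 => i _; apply: colour_prob_ge0.
Qed.

Lemma measurable_colouring_prob n Q l :
  measurable_fun setT (fun x => @colouring_prob x n Q l).
Proof.
rewrite /colouring_prob; case: pickle_inv => [s|]; last exact: measurable_cst.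
case: (Q _); last exact: measurable_cst.
suff prod m : measurable_fun setT
    (fun x => \prod_(i < m) colour_prob x i (nth 0%R s i))%E by apply: prod.
elim: m => [|m IH].
  by under eq_fun do rewrite big_ord0; apply: measurable_cst.
under eq_fun do rewrite big_ord_recr.
by apply: emeasurable_funM => //; apply: measurable_colour_prob.
Qed.

Section Colours.
Variables (x : Sdown R) (d : measure_display) (T : measurableType d).
Variables (P : probability T R) (X : nat -> T -> int).
Hypothesis mX : forall i k, measurable (X i @^-1` [set k]).
Hypothesis indX : forall n (B : nat -> set int),
  P (\bigcap_(i < n) (X i @^-1` B i)) = (\prod_(i < n) P (X i @^-1` B i))%E.
Hypothesis posX : forall i k, P (X i @^-1` [set k.+1%:Z]) = (x k)%:E.
Hypothesis negX : forall i, P (X i @^-1` [set - i.+1%:Z]) = dust x.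

Let regular i :=
  (\bigcup_k X i @^-1` [set k.+1%:Z]) `|` X i @^-1` [set - i.+1%:Z].

Let measurable_regular i : measurable (regular i).
Proof. by apply: measurableU => //; apply: bigcupT_measurable => k. Qed.

Let irregular0 i : P (~` regular i) = 0%E.
Proof.
have mpos : measurable (\bigcup_k X i @^-1` [set k.+1%:Z]).
  by apply: bigcupT_measurable => k.
have pos : P (\bigcup_k X i @^-1` [set k.+1%:Z]) = (\sum_(k <oo) (x k)%:E)%E.
  rewrite measure_semi_bigcup //.
    by apply: eq_eseriesr => k _; exact: posX.
  by move=> k k' _ _ [w [/= -> []]].
rewrite probability_setC //.
have -> : P (regular i) = 1%E; last by rewrite subee.
transitivity (\sum_(k <oo) (x k)%:E + dust x)%E.
  rewrite -pos -(negX i); apply: measureU => //.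
  by apply/seteqP; split=> w //= [[k _ ->]].
by rewrite addeC /dust subeK // sum_mass_fin.
Qed.

(** The listed masses already sum to 1, so all other colours are null. *)
Lemma colour_probE i k : P (X i @^-1` [set k]) = colour_prob x i k.
Proof.
have null k' : (forall w, regular i w -> X i w <> k') ->
    P (X i @^-1` [set k']) = 0%E.
  move=> reg; apply: (subset_measure0 (B := ~` regular i)) => //.
  - exact: measurableC.
  - by move=> w /= Xw /reg.
  - exact: irregular0.
case: k => [[|k]|j] /=; [|exact: posX|].
  by apply: null => w [[k _ /= ->]|/= ->].
case: eqP => [->|ji]; first by rewrite NegzE negX.
apply: null => w [[k _ /= ->]//|/= ->].
by rewrite -NegzE => -[/esym].
Qed.

Let coloured n (Q : pred {set {set 'I_n}}) (l : nat) : set T :=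
  if @pickle_inv (n.-tuple int) l is Some s then
    if Q (restr n (kernel_part (nth 0%R s)))
    then \bigcap_(i < n) (X i @^-1` [set nth 0%R s i]) else set0
  else set0.

Let measurable_coloured n Q l : measurable (@coloured n Q l).
Proof.
rewrite /coloured; case: pickle_inv => [s|//]; case: ifP => // _.
by apply: bigcap_measurableType => i _.
Qed.

Let colouredE n (Q : pred {set {set 'I_n}}) :
  [set w | Q (restr n (kernel_part (fun i => X i w)))] =
  \bigcup_l coloured Q l.
Proof.
apply/seteqP; split=> w /=.
  move=> Qw; pose s := [tuple X i w | i < n].
  have sE i : (i < n)%N -> nth 0 s i = X i w.
    by move=> ltin; rewrite -(tnth_nth _ _ (Ordinal ltin)) tnth_mktuple.
  exists (pickle s) => //; rewrite /coloured pickleK_inv.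
  rewrite (restr_kernel (Y := fun i => X i w)) // Qw => i /= ltin.
  by rewrite sE.
case=> l _; rewrite /coloured.
case: pickle_inv => [s|//]; case: ifP => // Qs sw.
by rewrite (restr_kernel (Y := nth 0 s)) // => i /sw.
Qed.

Let coloured_disjoint n (Q : pred {set {set 'I_n}}) :
  trivIset setT (coloured Q).
Proof.
(* pickle_inv, unlike unpickle, gives each tuple a single code *)
move=> l l' _ _ [w []]; rewrite /coloured.
have := @pickle_invK (n.-tuple int) l; have := @pickle_invK (n.-tuple int) l'.
case: pickle_inv => [s'|//]; case: pickle_inv => [s|//] /= <- <-.
case: ifP => // _; case: ifP => // _ sw s'w; congr pickle.
apply: val_inj; apply: (@eq_from_nth _ 0) => [|i].
  by rewrite !size_tuple.
rewrite size_tuple => ltin.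
by rewrite -(sw i) // -(s'w i).
Qed.

Lemma measurable_colour_event n (Q : pred {set {set 'I_n}}) :
  measurable [set w | Q (restr n (kernel_part (fun i => X i w)))].
Proof. by rewrite colouredE; apply: bigcupT_measurable. Qed.

Lemma colouring_probE n (Q : pred {set {set 'I_n}}) :
  P [set w | Q (restr n (kernel_part (fun i => X i w)))] =
  (\sum_(l <oo) colouring_prob x Q l)%E.
Proof.
rewrite colouredE (measure_semi_bigcup P) //; last exact: bigcupT_measurable.
apply: eq_eseriesr => l _; rewrite /coloured /colouring_prob.
case: pickle_inv => [s|]; last exact: measure0.
case: ifP => _; last exact: measure0.
apply: etrans (indX n (fun i => [set nth 0%R s i])) _.
by apply: eq_bigr => i _; exact: colour_probE.
Qed.

(** The colours of 0 and 1 agree only on a common positive colour, since the two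
    dust colours differ; all colours are then equal to it, with probability
    the sum of the powers of the masses. *)
Lemma one_colour_le n :
  (P [set w | restr n.+2 (kernel_part (fun i => X i w)) == one_part n.+2] <=
   (x 0%N ^+ n.+1)%:E)%E.
Proof.
pose U := \bigcup_k \bigcap_(i < n.+2) (X i @^-1` [set k.+1%:Z]).
pose N := ~` regular 0 `|` ~` regular 1.
have mk k : measurable (\bigcap_(i < n.+2) (X i @^-1` [set k.+1%:Z])).
  by apply: bigcap_measurableType => i _.
have mU : measurable U by apply: bigcupT_measurable.
have mN : measurable N by apply: measurableU; apply: measurableC.
have N0 : P N = 0%E.
  transitivity (P (~` regular 0)); last exact: irregular0.
  apply: measureU0; last exact: irregular0.
    exact: measurableC.
  exact: measurableC.
have sub : [set w | restr n.+2 (kernel_part (fun i => X i w)) == one_part n.+2]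
    `<=` U `|` N.
  move=> w /= /eqP /restr_oneP; move=> /(_ isT) eqX.
  have X0 i : (i < n.+2)%N -> X i w = X 0%N w.
    by move=> ltin; apply/eqP; apply: eqX.
  have [r0|r0] := pselect (regular 0 w); last by right; left.
  have [r1|r1] := pselect (regular 1 w); last by right; right.
  left; case: r0 => [[k _ /= Xk]|/= Xm]; last first.
    have X1 : X 1%N w = - 1%:Z by rewrite (X0 1%N) // Xm.
    by case: r1 => [[k _]|] /=; rewrite X1.
  by exists k => // i /= ltin; rewrite X0.
apply: (@le_trans _ _ (P (U `|` N))).
  apply: le_measure; rewrite ?inE //; last exact: measurableU.
  exact: (measurable_colour_event (fun p => p == one_part n.+2)).
have -> : P (U `|` N) = P U by exact: measureU0.
have -> : P U =
    (\sum_(k <oo) P (\bigcap_(i < n.+2) (X i @^-1` [set k.+1%:Z])))%E.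
  apply: measure_semi_bigcup => // k k' _ _ [w].
  by case=> /(_ 0%N isT) /= Xk /(_ 0%N isT) /=; rewrite Xk => -[].
apply: (@le_trans _ _ (\sum_(k <oo) (x 0%N ^+ n.+1)%:E * (x k)%:E)%E).
  apply: lee_nneseries => [k _ _|k _]; first exact: measure_ge0.
  rewrite (indX _ (fun=> [set k.+1%:Z])).
  under eq_bigr do rewrite posX.
  rewrite prodEFin prodr_const card_ord -EFinM lee_fin exprSr.
  by rewrite ler_wpM2r ?mass_ge0 // lerXn2r ?nnegrE ?mass_ge0 ?mass_le0.
rewrite nneseriesZl => [|k _]; last by rewrite lee_fin mass_ge0.
rewrite -[leRHS]mule1; apply: lee_wpmul2l; last exact: sum_mass_le1.
by rewrite lee_fin exprn_ge0 ?mass_ge0.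
Qed.

(** Together the colours 1 and 2 have probability 1. *)
Lemma two_colours n : 1 <= x 0%N + x 1%N ->
  P [set w | (2 < #|restr n (kernel_part (fun i => X i w))|)%N] = 0%E.
Proof.
move=> x01; pose H i := X i @^-1` [set 1%:Z] `|` X i @^-1` [set 2%:Z].
have mH i : measurable (H i) by apply: measurableU.
have H1 i : P (~` H i) = 0%E.
  have HE : P (H i) = (x 0%N + x 1%N)%:E.
    rewrite EFinD -(posX i 0) -(posX i 1); apply: measureU => //.
    by apply/seteqP; split=> w //= -[->].
  apply/eqP; rewrite eq_le measure_ge0 andbT probability_setC //.
  by rewrite sube_le0 HE lee_fin.
have : P.-negligible (\bigcup_i ~` H i).
  apply: negligible_bigcup => i.
  by apply/negligibleP; [exact: measurableC|exact: H1].
move=> negH; apply: measure_negligible.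
  exact: (measurable_colour_event (fun p => 2 < #|p|)%N).
apply: negligibleS negH => w /= gt2; apply: contrapT => noH.
have Hw i : H i w by apply: contrapT => nH; apply: noH; exists i.
move: gt2; rewrite ltnNge (@card_restr_kernel _ _ [:: 1%:Z; 2%:Z]) // => i _.
by rewrite !inE; case: (Hw i) => /= ->.
Qed.

End Colours.

Section Law.
Variable mu : Sdown R -> probability partN R.
Hypothesis hmu : forall x, paintbox_law x (mu x).

Lemma measurable_paintbox n (Q : pred {set {set 'I_n}}) :
  measurable_fun setT (fun x => mu x [set pi | Q (restr n pi)]).
Proof.
have -> : (fun x => mu x [set pi | Q (restr n pi)]) =
    (fun x => \sum_(l <oo) colouring_prob x Q l)%E.
  apply/funext => x; have [d [T [P [X [mX indX posX negX ->]]]]] := hmu x.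
    exact: (colouring_probE mX indX posX negX).
  exact: (measurable_restr Q).
apply: (ge0_emeasurable_sum (P := predT)) => [l x _ _|l _].
  exact: colouring_prob_ge0.
exact: measurable_colouring_prob.
Qed.

Lemma paintbox_one_le x n :
  (mu x [set pi | restr n.+2 pi = one_part n.+2] <= (x 0%N ^+ n.+1)%:E)%E.
Proof.
have [d [T [P [X [mX indX posX negX ->]]]]] := hmu x; last first.
  exact: (measurable_restr [set one_part n.+2]).
apply: le_trans (one_colour_le mX indX posX negX n).
rewrite le_eqVlt; apply/orP; left; apply/eqP; congr (P _).
by apply/seteqP; split=> w /= /eqP.
Qed.

Lemma paintbox_two x n : 1 <= x 0%N + x 1%N ->
  mu x [set pi | (2 < #|restr n pi|)%N] = 0%E.
Proof.
have [d [T [P [X [mX indX posX negX ->]]]]] := hmu x.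
  exact: (two_colours mX posX).
exact: (measurable_restr (fun p => 2 < #|p|)%N).
Qed.

End Law.
End Mass_partitions.

(** * The rate measures on cylinders *)

Section Rate_measures.
Variables (R : realType) (mu : Sdown R -> probability partN R).
Hypothesis hmu : forall x, paintbox_law x (mu x).
Implicit Types (nu : {measure set (Sdown R) -> \bar R}) (c : R).

Lemma mu_nu_restr nu n (Q : pred {set {set 'I_n}}) :
  (mu_nu mu nu [set pi | Q (restr n pi)] =
   \sum_(p | is_part p && Q p) mu_nu mu nu [set pi | restr n pi = p])%E.
Proof.
rewrite /mu_nu -big_filter -ge0_integral_sum //.
- apply: eq_integral => x _; rewrite big_filter; exact: measure_restr.
- move=> p; rewrite restr_eqE.
  exact: (measurable_paintbox hmu (pred1 p)).
Qed.

Lemma le_mu_nu nu n (Q : pred {set {set 'I_n}}) m (Q' : pred {set {set 'I_m}}) :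
    (forall pi, Q (restr n pi) -> Q' (restr m pi)) ->
  (mu_nu mu nu [set pi | Q (restr n pi)] <=
   mu_nu mu nu [set pi | Q' (restr m pi)])%E.
Proof.
move=> QQ'; apply: ge0_le_integral => // [||x _].
- exact: measurable_paintbox.
- exact: measurable_paintbox.
- exact: le_measure_restr.
Qed.

Lemma mu_nu_ge0 nu A : (0 <= mu_nu mu nu A)%E.
Proof. by apply: integral_ge0. Qed.

Lemma kappa_ge0 A : (0 <= kappa R A)%E.
Proof. by apply: esum_ge0. Qed.

Lemma erosion_ge0 A : (0 <= erosion R A)%E.
Proof. by apply: nneseries_ge0. Qed.

Lemma Cmeas_ge0 c nu A : 0 <= c -> (0 <= Cmeas mu c nu A)%E.
Proof. by move=> c0; rewrite adde_ge0 ?mule_ge0 ?kappa_ge0 ?mu_nu_ge0. Qed.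

Lemma Fmeas_ge0 c nu A : 0 <= c -> (0 <= Fmeas mu c nu A)%E.
Proof. by move=> c0; rewrite adde_ge0 ?mule_ge0 ?erosion_ge0 ?mu_nu_ge0. Qed.

Lemma kappa_restr n (Q : pred {set {set 'I_n}}) :
  (kappa R [set pi | Q (restr n pi)] =
   \sum_(p | is_part p && Q p) kappa R [set pi | restr n pi = p])%E.
Proof.
rewrite /kappa -esum_sum //; apply: eq_esum => ij _.
exact: (measure_restr (\d_(eps2 ij.1 ij.2) : {measure set partN -> \bar R})).
Qed.

Lemma erosion_restr n (Q : pred {set {set 'I_n}}) :
  (erosion R [set pi | Q (restr n pi)] =
   \sum_(p | is_part p && Q p) erosion R [set pi | restr n pi = p])%E.
Proof.
rewrite /erosion -nneseries_sum //; apply: eq_eseriesr => i _.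
exact: (measure_restr (\d_(eps1 i) : {measure set partN -> \bar R})).
Qed.

Lemma Cmeas_restr c nu n (Q : pred {set {set 'I_n}}) : 0 <= c ->
  (Cmeas mu c nu [set pi | Q (restr n pi)] =
   \sum_(p | is_part p && Q p) Cmeas mu c nu [set pi | restr n pi = p])%E.
Proof.
move=> c0; rewrite /Cmeas kappa_restr mu_nu_restr.
by rewrite ge0_sume_distrr ?big_split // => p _; apply: kappa_ge0.
Qed.

Lemma Fmeas_restr c nu n (Q : pred {set {set 'I_n}}) : 0 <= c ->
  (Fmeas mu c nu [set pi | Q (restr n pi)] =
   \sum_(p | is_part p && Q p) Fmeas mu c nu [set pi | restr n pi = p])%E.
Proof.
move=> c0; rewrite /Fmeas erosion_restr mu_nu_restr.
by rewrite ge0_sume_distrr ?big_split // => p _; apply: erosion_ge0.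
Qed.

Lemma le_Cmeas c nu n (Q : pred {set {set 'I_n}})
    m (Q' : pred {set {set 'I_m}}) :
    0 <= c -> (forall pi, Q (restr n pi) -> Q' (restr m pi)) ->
  (Cmeas mu c nu [set pi | Q (restr n pi)] <=
   Cmeas mu c nu [set pi | Q' (restr m pi)])%E.
Proof.
move=> c0 QQ'; apply: leeD; last exact: le_mu_nu.
apply: lee_wpmul2l => //; apply: le_esum => ij _.
exact: le_measure_restr.
Qed.

Lemma le_Fmeas c nu n (Q : pred {set {set 'I_n}})
    m (Q' : pred {set {set 'I_m}}) :
    0 <= c -> (forall pi, Q (restr n pi) -> Q' (restr m pi)) ->
  (Fmeas mu c nu [set pi | Q (restr n pi)] <=
   Fmeas mu c nu [set pi | Q' (restr m pi)])%E.
Proof.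
move=> c0 QQ'; apply: leeD; last exact: le_mu_nu.
apply: lee_wpmul2l => //; apply: lee_nneseries => // i _.
exact: le_measure_restr.
Qed.

(** Each pair i < j < n contributes the atom eps2 i j. *)
Lemma kappa_not_zero n :
  (('C(n, 2))%:R%:E <= kappa R [set pi | restr n pi != zero_part n])%E.
Proof.
pose s := [seq (i, j) | j <- iota 0 n, i <- iota 0 j].
have us : uniq s.
  apply: allpairs_uniq_dep => [|j _|[j i] [j' i'] _ _ [-> ->]//].
    exact: iota_uniq.
  exact: iota_uniq.
have sE ij : ij \in s -> (ij.1 < ij.2 < n)%N.
  case/allpairsPdep => j [i []]; rewrite !mem_iota !add0n /= => jn ij' ->.
  by rewrite ij' jn.
have size_s : size s = 'C(n, 2).
  rewrite size_allpairs_dep -triangular_sum sumnE big_map.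
  by rewrite /index_iota subn0; apply: eq_bigr => j _; rewrite size_iota.
apply: esum_ge; exists [set` s].
  by split=> [|ij /= /sE /andP[]//]; exact: finite_seq.
rewrite -fsbig_seq // big_seq.
under eq_bigr => ij ijs.
  rewrite diracE mem_set /=; last first.
    have /andP[lij ljn] := sE _ ijs.
    apply/eqP => /restr_zeroP /(_ ij.1 ij.2 (ltn_trans lij ljn) ljn) /= e.
    move: e; rewrite (ltn_eqF lij) !eqxx => /(_ isT) e.
    by move: lij; rewrite e ltnn.
  over.
rewrite -big_seq sumEFin lee_fin big_const_seq count_predT size_s.
by rewrite iter_addr_0.
Qed.

(** Detaching any one of the n + 2 points breaks the single block. *)
Lemma erosion_not_one n :
  (n.+2%:R%:E <= erosion R [set pi | restr n.+2 pi != one_part n.+2])%E.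
Proof.
apply: le_trans (nneseries_lim_ge n.+2 _); last by [].
rewrite big_mkord; under eq_bigr => i _.
  rewrite diracE mem_set /=; last first.
    apply/eqP => e; have := (restr_oneP (eps1 i) (ltn0Sn _)).1 e.
    have [->|i0] := eqVneq (i : nat) 0%N; first by move=> /(_ 0%N 1%N isT isT).
    move=> /(_ i 0%N (ltn_ord i) isT) /=.
    by rewrite eqxx (eq_sym 0%N) (negbTE i0).
  over.
by rewrite sumEFin sumr_const card_ord.
Qed.

End Rate_measures.

Lemma mu_nu_le (R : realType) (mu : Sdown R -> probability partN R)
    (nu : {measure set (Sdown R) -> \bar R}) n (Q : pred {set {set 'I_n}}) :
    (forall x, paintbox_law x (mu x)) ->
  (mu_nu mu nu [set pi | Q (restr n pi)] <= nu setT)%E.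
Proof.
move=> hmu; rewrite -[leRHS]mul1e -integral_cst //.
apply: ge0_le_integral => //; first exact: measurable_paintbox.
by move=> x _; apply: probability_le1; apply: (measurable_restr Q).
Qed.

(** Two atoms without dust colour the integers with two colours only. *)
Lemma mu_nu_binary (R : realType) (mu : Sdown R -> probability partN R)
    (nu : {measure set (Sdown R) -> \bar R}) n :
    (forall x, paintbox_law x (mu x)) ->
    nu [set x : Sdown R | x 0%N + x 1%N < 1] = 0%E ->
  mu_nu mu nu [set pi | (2 < #|restr n pi|)%N] = 0%E.
Proof.
move=> hmu nu0; pose N := [set x : Sdown R | x 0%N + x 1%N < 1].
have mN : measurable N.
  have mD : measurable_fun setT (fun x : Sdown R => x 0%N + x 1%N).
    by apply: measurable_funD; apply: measurable_mass.
  by have := mD measurableT _ (measurable_itv `]-oo, 1[); rewrite setTI;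
    congr measurable; apply/seteqP; split=> x /=; rewrite in_itv.
rewrite /mu_nu (ge0_negligible_integral mN) //; last first.
  exact: (measurable_paintbox hmu (fun p => 2 < #|p|)%N).
rewrite integral0_eq // => x [_ /= /negP]; rewrite -leNgt.
exact: paintbox_two.
Qed.

Lemma mass0_eq1 (R : realType) (x : Sdown R) :
  x 0%N = 1 -> forall i, x i = (i == 0%N)%:R.
Proof.
move=> x0 [|i]; first by rewrite x0.
apply/eqP; rewrite eq_le mass_ge0 andbT -(lerD2l 1) addr0 -lee_fin.
apply: le_trans (sum_mass_le1 x).
have := @nneseries_lim_ge R (fun i => (x i)%:E) predT 0%N i.+2.
rewrite big_mkord big_ord_recr /= big_ord_recl /= x0.
move=> /(_ (fun i _ _ => _)) h; apply: le_trans (h _); last first.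
  by move=> k; rewrite lee_fin mass_ge0.
rewrite EFinD leeD2r // leeDl //.
by apply: sume_ge0 => k _; rewrite lee_fin mass_ge0.
Qed.

(** Erosion alone splits the first j integers at rate j ce.  For dislocations,
    the lower bound 1 - x_1^(j-1) on the splitting probability increases to the
    indicator of x_1 < 1, whose integral is nu(S) since x_1 = 1 only at
    (1, 0, ...), which is null. *)
Lemma Fmeas_unbounded (R : realType) (mu : Sdown R -> probability partN R)
    (ce : R) (nu : {measure set (Sdown R) -> \bar R}) (M : R) :
    (forall x, paintbox_law x (mu x)) -> 0 <= ce ->
    nu [set x : Sdown R | forall i, x i = (i == 0%N)%:R] = 0%E ->
    fragments_quickly ce nu ->
  exists2 j, (0 < j)%N &
    (M%:E <= Fmeas mu ce nu [set pi | restr j pi != one_part j])%E.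
Proof.
move=> hmu ce0 nu0 [ce_gt0|nuT].
  exists (Num.truncn (M / ce)).+2 => //.
  apply: le_trans (leeDl _ (mu_nu_ge0 _ _ _)).
  apply: (@le_trans _ _ (ce%:E * (Num.truncn (M / ce)).+2%:R%:E)%E).
    rewrite -EFinM lee_fin mulrC -ler_pdivrMr //.
    apply: ltW; apply: lt_trans (truncnS_gt _) _.
    by rewrite ltr_nat.
  by apply: lee_wpmul2l; [rewrite lee_fin|exact: erosion_not_one].
pose g j (x : Sdown R) : \bar R := (1 - x 0%N ^+ j.+1)%:E.
have g0 j x : (0 <= g j x)%E.
  by rewrite lee_fin subr_ge0 exprn_ile1 ?mass_ge0 ?mass0_le1.
have mg j : measurable_fun setT (g j).
  apply/measurable_EFinP; apply: measurable_funB; first exact: measurable_cst.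
  by apply: measurable_funX; exact: measurable_mass.
have le_g j : (\int[nu]_x g j x <=
    Fmeas mu ce nu [set pi | restr j.+2 pi != one_part j.+2])%E.
  apply: le_trans (leeDr _ _); last by rewrite mule_ge0 ?erosion_ge0.
  apply: ge0_le_integral => //.
    exact: (measurable_paintbox hmu (fun p => p != one_part j.+2)).
  move=> x _; rewrite (_ : [set _ | _] =
      ~` [set pi | restr j.+2 pi = one_part j.+2]); last first.
    by apply/seteqP; split=> pi /= /eqP.
  rewrite probability_setC; last exact: (measurable_restr [set one_part j.+2]).
  by rewrite /g EFinB leeB // paintbox_one_le.
pose A := [set x : Sdown R | x 0%N < 1].
have mA : measurable A.
  have := @measurable_mass R 0%N measurableT _ (measurable_itv `]-oo, 1[).
  by rewrite setTI; congr measurable; apply/seteqP; split=> x /=;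
    rewrite in_itv.
have nuA : nu A = +oo%E.
  have A0 : nu (~` A) = 0%E.
    rewrite -nu0; congr (nu _); apply/seteqP; split=> x /=.
      move=> /negP; rewrite -leNgt => x0; apply: mass0_eq1.
      by apply/eqP; rewrite eq_le x0 mass0_le1.
    by move=> /(_ 0%N) x0; rewrite /A /= x0 ltxx.
  have : nu setT = (nu (~` A) + nu A)%E.
    rewrite -(setvU A); apply: measureU => //; first exact: measurableC.
    exact: setICl.
  by rewrite nuT A0 add0e.
have lim_g x : limn (g ^~ x) = (\1_A x)%:E.
  apply/cvg_lim => //; rewrite indicE.
  have [xA|xA] := boolP (x \in A); rewrite ?mem_set ?memNset //=.
    apply: cvg_EFin; first exact: nearW.
    rewrite -[1%:R in X in _ --> X]subr0; apply: cvgB; first exact: cvg_cst.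
    rewrite (cvg_shiftS (GRing.exp (x 0%N))); apply: cvg_expr.
    by rewrite ger0_norm ?mass_ge0; move: xA; rewrite inE.
  have x1 : x 0%N = 1.
    apply/eqP; rewrite eq_le mass0_le1 leNgt /=; apply: contraNN xA => x1.
    by rewrite inE.
  rewrite (_ : g ^~ x = cst 0%E); first exact: cvg_cst.
  by apply/funext => j; rewrite /g x1 expr1n subrr.
have cvg_g : (\int[nu]_x g j x)%E @[j --> \oo] --> +oo%E.
  have -> : +oo%E = (\int[nu]_x (\1_A x)%:E)%E.
    by rewrite integral_indic // setIT nuA.
  under eq_integral => x _ do rewrite -lim_g.
  apply: cvg_monotone_convergence => // x _ j k jk.
  by rewrite lee_fin lerB // ler_wiXn2l ?mass_ge0 ?mass0_le1.
have /cvgeyPge/(_ M)[j _ /(_ j (leqnn j)) Mj] := cvg_g.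
by exists j.+2 => //; apply: le_trans (le_g j).
Qed.

(** * Flow of the number of blocks *)

Section Flow.
Variables (R : realType) (mu : Sdown R -> probability partN R).
Variable q : forall n, {set {set 'I_n}} -> {set {set 'I_n}} -> R.
Variables (ck ce : R) (nuC nuD : {measure set (Sdown R) -> \bar R}).
Hypothesis hmu : forall x, paintbox_law x (mu x).
Hypothesis ck0 : 0 <= ck.
Hypothesis ce0 : 0 <= ce.
Hypothesis hq : has_characteristics q mu ck nuC ce nuD.

Variant jump n (a b : {set {set 'I_n}}) : Prop :=
| CoagJump p of is_part p & p != zero_part #|a| & b = coag (a := a) p
| FragJump (k : 'I_#|a|) (p : {set {set 'I_#|block a k|}})
    of is_part p & p != one_part #|block a k| & b = frag (a := a) (k := k) p
| NoJump of q a b = 0.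

Lemma jumpP n (a b : {set {set 'I_n}}) :
  is_part a -> is_part b -> b <> a -> jump a b.
Proof.
move=> pa pb ba; have [_ _ q0] := hq pa.
have [[p pp bE]|nC] := pselect (is_coag a b).
  apply: (CoagJump pp) => //; apply/eqP => p0.
  by apply: ba; rewrite bE p0 coag_zero.
have [[k [p [pp bE]]]|nF] := pselect (is_frag a b).
  apply: (FragJump pp) => //; apply/eqP => p1.
  by apply: ba; rewrite bE p1 frag_one.
by apply: NoJump; apply: q0.
Qed.

Lemma q_coag n (a : {set {set 'I_n}}) p :
    is_part a -> is_part p -> p != zero_part #|a| ->
  (q a (coag p))%:E = Cmeas mu ck nuC [set pi | restr #|a| pi = p].
Proof. by move=> pa pp /eqP p0; have [-> //] := hq pa. Qed.

Lemma q_frag n (a : {set {set 'I_n}}) (k : 'I_#|a|) p :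
    is_part a -> is_part p -> p != one_part #|block a k| ->
  (q a (frag (k := k) p))%:E =
  Fmeas mu ce nuD [set pi | restr #|block a k| pi = p].
Proof. by move=> pa pp /eqP p1; have [_ ->] := hq pa. Qed.

Lemma q_ge0 n (a b : {set {set 'I_n}}) :
  is_part a -> is_part b -> b <> a -> 0 <= q a b.
Proof.
move=> pa pb ba; case: (jumpP pa pb ba) => [p pp p0 ->|k p pp p1 ->|-> //].
  by rewrite -lee_fin q_coag // Cmeas_ge0.
by rewrite -lee_fin q_frag // Fmeas_ge0.
Qed.

Lemma sum_q_coag n (a : {set {set 'I_n}}) (Q : pred {set {set 'I_#|a|}}) :
    is_part a -> (forall p, Q p -> p != zero_part #|a|) ->
  (\sum_(p | is_part p && Q p) q a (coag p))%:E =
  Cmeas mu ck nuC [set pi | Q (restr #|a| pi)].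
Proof.
move=> pa Q0; rewrite (Cmeas_restr hmu) // -sumEFin.
by apply: eq_bigr => p /andP[pp /Q0]; apply: q_coag.
Qed.

Lemma sum_q_frag n (a : {set {set 'I_n}}) (k : 'I_#|a|)
    (Q : pred {set {set 'I_#|block a k|}}) :
    is_part a -> (forall p, Q p -> p != one_part #|block a k|) ->
  (\sum_(p | is_part p && Q p) q a (frag (k := k) p))%:E =
  Fmeas mu ce nuD [set pi | Q (restr #|block a k| pi)].
Proof.
move=> pa Q1; rewrite (Fmeas_restr hmu) // -sumEFin.
by apply: eq_bigr => p /andP[pp /Q1]; apply: q_frag.
Qed.

Lemma card_block_gt0 n (a : {set {set 'I_n}}) (k : 'I_#|a|) :
  is_part a -> (0 < #|block a k|)%N.
Proof.
move=> pa; have [x xk] := part_neq0 pa (mem_block k).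
by rewrite card_gt0; apply/finset.set0Pn; exists x.
Qed.

(** This is the total rate at which the chain on [m] leaves the partition into
    singletons by a coalescence: a finite sum of real numbers. *)
Lemma Cmeas_not_zero_fin m :
  exists2 c : R, 0 <= c &
    Cmeas mu ck nuC [set pi | restr m pi != zero_part m] = c%:E.
Proof.
rewrite -[m]card_zero_part.
have e := sum_q_coag (Q := fun p => p != zero_part #|zero_part m|)
  (is_part_zero m) (fun p p0 => p0).
by eexists; last exact: (esym e); rewrite -lee_fin e Cmeas_ge0.
Qed.

(** A coalescence of more than K blocks into at most K merges two of the first
    K + 1 blocks. *)
Lemma inflow_le n (a : {set {set 'I_n}}) K :
    is_part a -> (K < #|a|)%N ->
  ((\sum_(b | is_part b && (#|b| <= K)%N) q a b)%:E <=
   Cmeas mu ck nuC [set pi | restr K.+1 pi != zero_part K.+1])%E.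
Proof.
move=> pa ltKa.
apply: (@le_trans _ _ (Cmeas mu ck nuC [set pi | #|restr #|a| pi| <= K]%N)).
  have smallP (p : {set {set 'I_#|a|}}) :
      (#|p| <= K)%N -> p != zero_part #|a|.
    by apply: contraTneq => ->; rewrite card_zero_part -ltnNge.
  rewrite -(sum_q_coag (Q := fun p => (#|p| <= K)%N)) // lee_fin.
  apply: sum_surj_le => [p /andP[pp pK]|b /andP[pb bK] qb].
    by rewrite -lee_fin q_coag ?smallP // Cmeas_ge0.
  have ba : b <> a by move=> ba; move: ltKa; rewrite -ba ltnNge bK.
  case: (jumpP pa pb ba) => [p pp p0 bE|k p pp p1 bE|q0].
  - by exists p; rewrite // pp /= -(card_coag pa) -bE.
  - have := card_frag pa pp; rewrite -bE => e.
    have := leq_ltn_trans bK ltKa.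
    rewrite [leqLHS]e -[leqRHS]addn0 leq_add2l leqNgt.
    by rewrite card_part_gt0 ?card_block_gt0.
  - by rewrite q0 eqxx in qb.
apply: (le_Cmeas hmu nuC (Q := fun p => (#|p| <= K)%N)
  (Q' := fun p => p != zero_part K.+1) ck0) => pi piK.
apply: contraTneq piK => e; rewrite -ltnNge.
by have := card_restr_mono pi ltKa; rewrite /= e card_zero_part.
Qed.

(** Distinct splittings of the block k lead to distinct partitions, and a block
    is split whenever its first j elements are separated. *)
Lemma outflow_ge n (a : {set {set 'I_n}}) (k : 'I_#|a|) j :
    is_part a -> (0 < j <= #|block a k|)%N ->
  (Fmeas mu ce nuD [set pi | restr j pi != one_part j] <=
   (\sum_(b | is_part b && ~~ (#|b| <= #|a|)%N) q a b)%:E)%E.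
Proof.
move=> pa /andP[j0 jk]; have k0 := card_block_gt0 k pa.
apply: (@le_trans _ _
    (Fmeas mu ce nuD
      [set pi | restr #|block a k| pi != one_part #|block a k|])).
  apply: (le_Fmeas hmu nuD (Q := fun p => p != one_part j)
    (Q' := fun p => p != one_part #|block a k|) ce0) => pi.
  apply: contra => /eqP /(restr_oneP _ k0) all1.
  apply/eqP/(restr_oneP _ j0).
  by move=> i i' ij i'j; apply: all1; apply: leq_trans jk.
rewrite -(sum_q_frag (Q := fun p => p != one_part #|block a k|)) // lee_fin.
apply: sum_inj_le => [p p' /andP[pp _] /andP[pp' _]|p /andP[pp /eqP p1]|b].
- exact: frag_inj.
- rewrite is_part_frag //= -ltnNge -ltnS card_frag // -[#|a|.+1]addn1 ltn_add2l.
  exact: card_part_gt1.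
- case/andP=> pb; rewrite -ltnNge => ab; apply: q_ge0 => // ba.
  by rewrite ba ltnn in ab.
Qed.

(** Each of the pairs of blocks merges at rate at least ck. *)
Lemma inflow_ge n (a : {set {set 'I_n}}) K :
    is_part a -> #|a| = K.+1 ->
  ck * ('C(K.+1, 2))%:R <= \sum_(b | is_part b && (#|b| <= K)%N) q a b.
Proof.
move=> pa aK; rewrite -lee_fin EFinM.
apply: (@le_trans _ _
    (Cmeas mu ck nuC [set pi | restr #|a| pi != zero_part #|a|])).
  apply: le_trans (leeDl _ (mu_nu_ge0 _ _ _)).
  by rewrite -aK; apply: lee_wpmul2l; [rewrite lee_fin|exact: kappa_not_zero].
rewrite -(sum_q_coag (Q := fun p => p != zero_part #|a|)) // lee_fin.
apply: sum_inj_le => [p p' _ _|p /andP[pp p0]|b].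
- exact: coag_inj.
- rewrite is_part_coag //= card_coag // -ltnS -aK.
  rewrite ltn_neqAle card_part_le // andbT.
  by apply: contraNneq p0 => /(card_part_max pp) ->.
- case/andP=> pb bK; apply: q_ge0 => // ba.
  by move: bK; rewrite ba aK ltnn.
Qed.

(** When a block is only ever split into two, the number of blocks grows by
    one at a time, each block being split at rate at most D. *)
Lemma outflow_le D n (a : {set {set 'I_n}}) K :
    ce = 0 -> nuD setT = D%:E ->
    nuD [set x : Sdown R | x 0%N + x 1%N < 1] = 0%E ->
    is_part a -> (#|a| <= K)%N ->
  \sum_(b | is_part b && ~~ (#|b| <= K)%N) q a b <=
  if #|a| == K then K%:R * D else 0.
Proof.
move=> ce_0 nuDT binary pa aK.
have FmeasE A : Fmeas mu ce nuD A = mu_nu mu nuD A.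
  by rewrite /Fmeas ce_0 mul0e add0e.
have jump_frag b : is_part b -> (K < #|b|)%N -> q a b != 0 ->
    #|a| = K /\ exists (k : 'I_#|a|) (p : {set {set 'I_#|block a k|}}),
      [/\ is_part p, p != one_part #|block a k| & b = frag (a := a) (k := k) p].
  move=> pb Kb qb; have ba : b <> a by move=> ba; rewrite ba ltnNge aK in Kb.
  case: (jumpP pa pb ba) => [p pp p0 bE|k p pp p1 bE|q0]; first 1 last.
  - split; last by exists k, p.
    (* splittings into three or more pieces have rate 0 *)
    have p2 : (#|p| <= 2)%N.
      rewrite leqNgt; apply: contra qb => p2; rewrite bE.
      apply/eqP/EFin_inj; rewrite q_frag // FmeasE.
      apply/eqP; rewrite eq_le mu_nu_ge0 andbT restr_eqE.
      rewrite -[leRHS](mu_nu_binary #|block a k| hmu binary).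
      by apply: (le_mu_nu hmu nuD (Q := pred1 p) (Q' := fun p => (2 < #|p|)%N))
        => pi /eqP ->.
    have := card_frag pa pp; rewrite -bE => e.
    apply/eqP; rewrite eqn_leq aK -(leq_add2r 2) addn2.
    by apply: leq_trans (_ : _ <= #|b|.+1)%N _ => //; rewrite e leq_add2l.
  - by rewrite q0 eqxx in qb.
  - by move: Kb; rewrite bE card_coag // ltnNge (leq_trans (card_part_le pp)).
case: eqP => [aKE|aNK]; last first.
  rewrite big1 // => b /andP[pb]; rewrite -ltnNge => Kb.
  apply/eqP/negP => /negP qb.
  by have [] := jump_frag _ pb Kb qb.
apply: (@le_trans _ _ (\sum_(k : 'I_#|a|)
    \sum_(p | is_part p && (p != one_part #|block a k|))
      q a (frag (k := k) p))).
  rewrite (sig_big_dep xpredT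
    (fun (k : 'I_#|a|) (p : {set {set 'I_#|block a k|}}) =>
       is_part p && (p != one_part #|block a k|))
    (fun k p => q a (frag (k := k) p))) /=.
  apply: (sum_surj_le
    (f := fun kp : {k : 'I_#|a| & {set {set 'I_#|block a k|}}} =>
    frag (a := a) (k := tag kp) (tagged kp))).
    move=> [k p] /= /andP[pp p1].
    by rewrite -lee_fin q_frag // Fmeas_ge0.
  move=> b /andP[pb]; rewrite -ltnNge => Kb qb.
  have [_ [k [p [pp p1 bE]]]] := jump_frag _ pb Kb qb.
  exists (Tagged (fun k : 'I_#|a| => {set {set 'I_#|block a k|}}) p) => //=.
  by rewrite pp.
apply: (@le_trans _ _ (\sum_(k : 'I_#|a|) D)); last first.
  by rewrite sumr_const card_ord aKE mulr_natl.
apply: ler_sum => k _; rewrite -lee_fin sum_q_frag // FmeasE -nuDT.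
exact: (mu_nu_le nuD (fun p => p != one_part #|block a k|) hmu).
Qed.

End Flow.

(** * The number of blocks at equilibrium *)

Section Equilibrium.
Variables (R : realType) (K : R -> R.-pker partN ~> partN).
Variable q : forall n, {set {set 'I_n}} -> {set {set 'I_n}} -> R.
Variables (mu : Sdown R -> probability partN R).
Variables (ck ce : R) (nuC nuD : {measure set (Sdown R) -> \bar R}).
Variable rho : probability partN R.
Hypothesis hmu : forall x, paintbox_law x (mu x).
Hypothesis hK : forall n, restr_markov_chain K q n.
Hypothesis ck0 : 0 <= ck.
Hypothesis ce0 : 0 <= ce.
Hypothesis hq : has_characteristics q mu ck nuC ce nuD.
Hypothesis hrho : stationary K rho.

Definition card_prob n (Q : pred nat) : R :=
  \sum_(a : {set {set 'I_n}} | is_part a && Q #|a|) restr_prob rho a.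

Lemma card_probE n (Q : pred nat) :
  rho [set pi | Q #|restr n pi|] = (card_prob n Q)%:E.
Proof. exact: (restr_probE (probability_setT rho) (fun a => Q #|a|)). Qed.

Lemma card_prob_ge0 n Q : 0 <= card_prob n Q.
Proof. by apply: sumr_ge0 => a _; apply: restr_prob_ge0. Qed.

Lemma card_prob_le1 n Q : card_prob n Q <= 1.
Proof.
rewrite -lee_fin -card_probE; apply: probability_le1.
exact: (measurable_restr (fun a => Q #|a|)).
Qed.

Lemma flow_balance n J :
  \sum_(a : {set {set 'I_n}} | is_part a && (#|a| <= J)%N) restr_prob rho a *
    (\sum_(b | is_part b && ~~ (#|b| <= J)%N) q a b) =
  \sum_(a : {set {set 'I_n}} | is_part a && ~~ (#|a| <= J)%N) restr_prob rho a *
    (\sum_(b | is_part b && (#|b| <= J)%N) q a b).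
Proof. exact: (balance (fun a => #|a| <= J)%N (hK n) hrho). Qed.

(** With K blocks among n * K integers some block has at least n elements, so
    the mass leaving the partitions with at most K blocks would be unbounded
    if having exactly K blocks kept a positive probability, while the mass
    entering them is bounded. *)
Lemma card_prob_bound J : (0 < J)%N ->
    (forall M : R, exists2 j, (0 < j)%N &
      (M%:E <= Fmeas mu ce nuD [set pi | restr j pi != one_part j])%E) ->
  exists2 c : R, 0 <= c & forall M : R, 0 <= M ->
    exists N, forall n, (N <= n)%N ->
    (M%:E * rho [set pi | #|restr n pi| = J] <= c%:E)%E.
Proof.
move=> J0 unb; have [c c0 cE] := Cmeas_not_zero_fin hmu ck0 hq J.+1.
exists c => // M M0; have [j j0 Mj] := unb M.
exists (J * j)%N => n Jjn.
have -> : rho [set pi | #|restr n pi| = J] = (card_prob n (pred1 J))%:E.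
  rewrite -card_probE; congr (rho _).
  by apply/seteqP; split=> pi /= /eqP.
have q0 (a b : {set {set 'I_n}}) :
    is_part a -> is_part b -> b <> a -> 0 <= q a b.
  exact: (q_ge0 ck0 ce0 hq).
rewrite -EFinM lee_fin.
apply: (@le_trans _ _ (\sum_(a : {set {set 'I_n}} | is_part a && (#|a| <= J)%N)
    restr_prob rho a * (\sum_(b | is_part b && ~~ (#|b| <= J)%N) q a b))).
  rewrite /card_prob mulr_sumr big_mkcond [leRHS]big_mkcond.
  apply: ler_sum => a _.
  have [pa|//] := boolP (is_part a); rewrite [_ && _]/=.
  have out0 : (#|a| <= J)%N ->
      0 <= \sum_(b | is_part b && ~~ (#|b| <= J)%N) q a b.
    move=> aJ; apply: sumr_ge0 => b /andP[pb bJ]; apply: q0 => // ba.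
    by move: bJ; rewrite ba aJ.
  case: eqP => [aJ|_] /=; last first.
    by case: ifP => // /out0 ?; rewrite mulr_ge0 ?restr_prob_ge0.
  rewrite aJ leqnn mulrC ler_wpM2l ?restr_prob_ge0 //.
  have [k jk] := large_block pa J0 aJ Jjn.
  rewrite -lee_fin; apply: (le_trans Mj); move: jk; rewrite -[in leRHS]aJ => jk.
  by apply: (outflow_ge hmu ck0 ce0 hq) => //; rewrite j0; exact: jk.
rewrite flow_balance.
apply: (@le_trans _ _
  (\sum_(a : {set {set 'I_n}} | is_part a && ~~ (#|a| <= J)%N)
    restr_prob rho a * c)).
  apply: ler_sum => a /andP[pa]; rewrite -ltnNge => aJ.
  rewrite ler_wpM2l ?restr_prob_ge0 // -lee_fin -cE.
  exact: (inflow_le hmu ck0 hq).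
rewrite -mulr_suml -[leRHS]mul1r ler_wpM2r //.
exact: (card_prob_le1 n (fun k => ~~ (k <= J)%N)).
Qed.

(** The probability of having J blocks in [n] for all large n, multiplied by any
    M, stays below a fixed c. *)
Lemma quick_infinite :
    (forall M : R, exists2 j, (0 < j)%N &
      (M%:E <= Fmeas mu ce nuD [set pi | restr j pi != one_part j])%E) ->
  rho [set pi | finite_set (blocksN pi)] = 0%E.
Proof.
move=> unb.
pose E J N :=
  \bigcap_(n in [set n | (N <= n)%N]) [set pi | #|restr n pi| = J.+1].
have mr n J : measurable [set pi | #|restr n pi| = J].
  exact: (measurable_restr (fun a => #|a| = J)).
have mE J N : measurable (E J N) by apply: bigcap_measurableType => n _.
have E0 J N : rho (E J N) = 0%E.
  have [c c0 bound] := card_prob_bound (ltn0Sn J) unb.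
  have rE : rho (E J N) \is a fin_num by rewrite fin_num_measure.
  have le_c M : 0 <= M -> M * fine (rho (E J N)) <= c.
    move=> M0; have [N' /(_ (maxn N N') (leq_maxr _ _)) le_c] := bound M M0.
    rewrite -lee_fin EFinM fineK //; apply: le_trans le_c.
    apply: lee_wpmul2l => //; apply: le_measure; rewrite ?inE // => pi.
    by apply; rewrite /= leq_maxl.
  rewrite -(fineK rE); congr EFin; apply/eqP; apply/negPn/negP => rho0.
  have rho_gt0 : 0 < fine (rho (E J N)) by rewrite lt_def rho0 fine_ge0.
  have : (c + 1) / fine (rho (E J N)) * fine (rho (E J N)) <= c.
    by apply: le_c; rewrite divr_ge0 ?addr_ge0 // ltW.
  by rewrite divfK // gerDl ler10.
apply: measure_negligible; first exact: measurable_finite_blocks.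
apply: (@negligibleS _ _ _ _ (\bigcup_J \bigcup_N E J N)); last first.
  apply: negligible_bigcup => J; apply: negligible_bigcup => N.
  by apply/negligibleP; [exact: mE|exact: E0].
move=> pi /card_restr_stationary[N stat].
(* [0] has no block, hence N.+1 instead of N *)
have : (0 < #|restr N.+1 pi|)%N.
  by apply: card_part_gt0 => //; apply: is_part_restr.
case cE : #|restr N.+1 pi| => [//|J] _; exists J => //; exists N => // n /= Nn.
by rewrite stat // -cE stat.
Qed.

(** The balance of the flow between at most k and more than k blocks gives
    P(k + 1 blocks) ck k (k + 1) / 2 <= P(k blocks) k D, that is
    P(k + 1 blocks) ck (k + 1) <= 2 D P(k blocks).  Sum over k >= J, bounding
    ck (J + 1) by ck (k + 1). *)
Lemma card_prob_tail D n J :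
    ce = 0 -> nuD setT = D%:E ->
    nuD [set x : Sdown R | x 0%N + x 1%N < 1] = 0%E -> (0 < J)%N ->
  card_prob n (fun k => J < k)%N * (ck * J.+1%:R) <= 2 * D.
Proof.
move=> ce_0 nuDT binary J0.
have D0 : 0 <= D by rewrite -lee_fin -nuDT.
have step k : (0 < k)%N ->
    card_prob n (pred1 k.+1) * (ck * k.+1%:R) <= 2 * D * card_prob n (pred1 k).
  move=> k0.
  have in_ge : card_prob n (pred1 k.+1) * (ck * ('C(k.+1, 2))%:R) <=
      \sum_(a : {set {set 'I_n}} | is_part a && ~~ (#|a| <= k)%N)
        restr_prob rho a * (\sum_(b | is_part b && (#|b| <= k)%N) q a b).
    rewrite /card_prob mulr_suml big_mkcond [leRHS]big_mkcond.
    apply: ler_sum => a _.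
    have [pa|//] := boolP (is_part a); rewrite [_ && _]/=.
    case: eqP => [ak|_] /=; last first.
      case: ifP => // ak; rewrite mulr_ge0 ?restr_prob_ge0 //.
      apply: sumr_ge0 => b /andP[pb bk]; apply: (q_ge0 ck0 ce0 hq) => // ba.
      by move: ak; rewrite -ba bk.
    rewrite ak ltnn /= ler_wpM2l ?restr_prob_ge0 //.
    exact: (inflow_ge hmu ck0 ce0 hq).
  have out_le : \sum_(a : {set {set 'I_n}} | is_part a && (#|a| <= k)%N)
      restr_prob rho a * (\sum_(b | is_part b && ~~ (#|b| <= k)%N) q a b) <=
      card_prob n (pred1 k) * (k%:R * D).
    rewrite /card_prob mulr_suml big_mkcond [leRHS]big_mkcond.
    apply: ler_sum => a _.
    have [pa|//] := boolP (is_part a); rewrite [_ && _]/=.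
    case: ifP => ak; last first.
      by rewrite [pred1 k _]/= (gtn_eqF _) // ltnNge ak.
    have := outflow_le hmu ce0 hq ce_0 nuDT binary pa ak.
    move=> /(ler_wpM2l (restr_prob_ge0 rho a)) /le_trans; apply.
    by rewrite /=; case: (#|a| == k); rewrite ?mulr0.
  rewrite flow_balance in out_le.
  have in_out := le_trans in_ge out_le.
  have kR : 0 < k%:R :> R by rewrite ltr0n.
  have bin2R : 2 * ('C(k.+1, 2))%:R = k.+1%:R * k%:R :> R.
    by rewrite -!natrM -mul_bin_diag bin1.
  rewrite -(ler_pM2r kR).
  rewrite (_ : _ * _ * k%:R =
    2 * (card_prob n (pred1 k.+1) * (ck * ('C(k.+1, 2))%:R))); last first.
    by rewrite !(mulrCA 2) bin2R !mulrA.
  rewrite (_ : 2 * D * _ * k%:R = 2 * (card_prob n (pred1 k) * (k%:R * D))).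
    by rewrite ler_pM2l.
  by rewrite -!mulrA (mulrCA D) (mulrC D).
have split k : card_prob n (fun i => k <= i)%N =
    card_prob n (pred1 k) + card_prob n (fun i => k < i)%N.
  rewrite /card_prob (bigID (fun a : {set {set 'I_n}} => #|a| == k)) /=.
  congr (_ + _); apply: eq_bigl => a; rewrite -andbA; congr (_ && _).
    by case: eqP => [->|]; rewrite ?leqnn ?andbF.
  by rewrite ltn_neqAle eq_sym andbC.
(* descending induction from k >= n, where the left side vanishes *)
have tail d k : (0 < k)%N -> (n <= k + d)%N ->
    card_prob n (fun i => k < i)%N * (ck * k.+1%:R) <=
    2 * D * card_prob n (fun i => k <= i)%N.
  elim: d k => [|d IH] k k0 nkd.
    rewrite {1}/card_prob big1 ?mul0r ?mulr_ge0 ?card_prob_ge0 //.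
    move=> a /andP[pa].
    by rewrite ltnNge (leq_trans (card_part_le pa)) // -[k]addn0.
  rewrite [in leRHS]split [in leLHS](split k.+1) mulrDl mulrDr lerD ?step //.
  apply: le_trans (IH k.+1 _ _) => //; last by rewrite addSnnS.
  by rewrite ler_wpM2l ?card_prob_ge0 // ler_wpM2l // ler_nat.
apply: le_trans (tail n J J0 (leq_addl _ _)) _.
by rewrite -[leRHS]mulr1 ler_wpM2l ?mulr_ge0 ?card_prob_le1.
Qed.

(** The bound 2 D / (ck (J + 1)) passes to the limit in n along the increasing
    events of having more than J blocks in [n], and tends to 0 with J. *)
Lemma slow_finite D :
    ce = 0 -> nuD setT = D%:E ->
    nuD [set x : Sdown R | x 0%N + x 1%N < 1] = 0%E -> 0 < ck ->
  rho [set pi | finite_set (blocksN pi)] = 1%E.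
Proof.
move=> ce_0 nuDT binary ck_gt0.
have D0 : 0 <= D by rewrite -lee_fin -nuDT.
pose U J := \bigcup_n [set pi | (J < #|restr n pi|)%N].
have mr n J : measurable [set pi | (J < #|restr n pi|)%N].
  exact: (measurable_restr (fun a => J < #|a|)%N).
have mU J : measurable (U J) by apply: bigcupT_measurable.
have rhoU J : (0 < J)%N -> (rho (U J) <= (2 * D / (ck * J.+1%:R))%:E)%E.
  move=> J0.
  have cv : rho [set pi | (J < #|restr n pi|)%N] @[n --> \oo] --> rho (U J).
    apply: nondecreasing_cvg_mu => [n||n m nm]; [exact: mr|exact: mU|].
    apply/subsetPset => pi /= lt.
    exact: leq_trans lt (card_restr_mono pi nm).
  rewrite -(cvg_lim _ cv) //; apply: lime_le.
    by apply/cvg_ex; eexists; exact: cv.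
  apply: nearW => n; rewrite card_probE lee_fin ler_pdivlMr ?mulr_gt0 //.
  exact: card_prob_tail.
have inf0 : rho [set pi | ~ finite_set (blocksN pi)] = 0%E.
  apply/eqP; rewrite eq_le measure_ge0 andbT; apply/lee_addgt0Pr => e e0.
  rewrite add0e; pose J := (Num.truncn (2 * D / (ck * e))).+1.
  apply: (@le_trans _ _ (rho (U J))).
    apply: le_measure; rewrite ?inE //.
      by apply: measurableC; exact: measurable_finite_blocks.
    by rewrite infinite_blocksE => pi /(_ J Logic.I).
  apply: le_trans (rhoU _ _) _ => //; rewrite lee_fin ler_pdivrMr ?mulr_gt0 //.
  have : 2 * D / (ck * e) < J.+1%:R.
    by apply: lt_trans (truncnS_gt _) _; rewrite ltr_nat.
  rewrite ltr_pdivrMr ?mulr_gt0 // => /ltW.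
  by rewrite [leRHS]mulrC -mulrA [leRHS]mulrCA.
have := probability_setC rho (measurableC measurable_finite_blocks).
by rewrite setCK => ->; rewrite [X in (1 - X)%E]inf0 sube0.
Qed.

End Equilibrium.

Theorem theorem9 (R : realType)
    (d : measure_display) (T : measurableType d) (P : probability T R)
    (Pi : R -> T -> partN) (K : R -> R.-pker partN ~> partN)
    (q : forall n, {set {set 'I_n}} -> {set {set 'I_n}} -> R)
    (mu : Sdown R -> probability partN R)
    (ck ce : R) (nuC nuD : {measure set (Sdown R) -> \bar R})
    (rho : probability partN R)
    (hmu : forall x, paintbox_law x (mu x))
    (hPi : EFC_process P Pi K q)
    (hchar : characteristics ck nuC ce nuD)
    (hq : has_characteristics q mu ck nuC ce nuD)
    (hnz : ~ [/\ ck = 0, nuC setT = 0%E, ce = 0 & nuD setT = 0%E])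
    (hrho : stationary K rho) :
  (fragments_quickly ce nuD ->
     rho [set pi | finite_set (blocksN pi)] = 0%E) /\
  (fragments_slowly ce nuD ->
     nuD [set x : Sdown R | x 0%N + x 1%N < 1] = 0%E ->
     0 < ck ->
     rho [set pi | finite_set (blocksN pi)] = 1%E).
Proof.
have [_ _ _ hK _] := hPi; have [[ck0 ce0] _ _ nuD1 _] := hchar.
split=> [quick|[ce_0 nuDfin] binary ck_gt0].
  apply: (quick_infinite hmu hK ck0 ce0 hq hrho) => M.
  exact: Fmeas_unbounded.
have nuDE : nuD setT = (fine (nuD setT))%:E by rewrite fineK ?ge0_fin_numE.
exact: (slow_finite hmu hK ck0 ce0 hq hrho ce_0 nuDE binary ck_gt0).
Qed.
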